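(* For every positive integer $p$ and every nonnegative integer $n$, the sum $I_p=\sum_{k=1}^{p-1}\frac{1}{\sin(k\pi/p)}$ satisfies $$I_p<\frac{2p}{\pi}\left(\ln p+\gamma-\ln(\pi/2)\right)+\sum_{k=1}^{2n}(-1)^k\frac{(2^{2k}-2)b_{2k}^2}{k\cdot(2k)!}\left(\frac{\pi}{p}\right)^{2k-1}$$ and $$I_p>\frac{2p}{\pi}\left(\ln p+\gamma-\ln(\pi/2)\right)+\sum_{k=1}^{2n+1}(-1)^k\frac{(2^{2k}-2)b_{2k}^2}{k\cdot(2k)!}\left(\frac{\pi}{p}\right)^{2k-1}.$$
   Context: The Bernoulli polynomials $(B_n)_{n\ge 0}$ are the unique sequence of real polynomials with $B_0(X)=1$ and, for all $n\ge1$, $B_n(X+1)-B_n(X)=nX^{n-1}$ and $\int_0^1B_n(t)\,dt=0$; the Bernoulli numbers are $b_n=B_n(0)$. $\gamma$ is the Euler–Mascheroni constant. Empty sums are $0$ (so $I_1=0$). *)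

(* Defs.v *)
From Stdlib Require Import Reals Lra Lia.
From Coquelicot Require Import Coquelicot.
Open Scope R_scope.

Definition poly_of_degree_le (d : nat) (f : R -> R) : Prop :=
  exists c : nat -> R, forall x : R, f x = sum_n (fun k => c k * x ^ k) d.

(* Real polynomials are identified with polynomial functions on R. *)
Definition is_polynomial (f : R -> R) : Prop :=
  exists d : nat, poly_of_degree_le d f.

Definition is_bernoulli_polynomials (B : nat -> R -> R) : Prop :=
  (forall n : nat, is_polynomial (B n)) /\
  (forall x : R, B 0%nat x = 1) /\
  (forall n : nat, (1 <= n)%nat ->
     (forall x : R, B n (x + 1) - B n x = INR n * x ^ (n - 1)) /\
     is_RInt (B n) 0 1 0).

Definition euler_gamma : R :=
  real (Lim_seq (fun n => sum_n_m (fun k => / INR k) 1 n - ln (INR n))).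

(* [sum_n_m a i j] is zero when [j < i]; in particular [cosecant_sum 1 = 0]. *)
Definition cosecant_sum (p : nat) : R :=
  sum_n_m (fun k => 1 / sin (INR k * PI / INR p)) 1 (p - 1).

Lemma poly_continuous (f : R -> R) (x : R) : is_polynomial f -> continuous f x.
Proof.
  intros [d [c Hc]].
  apply continuous_ext with (fun x => sum_n (fun k => c k * x ^ k) d).
  { intros y; now rewrite Hc. }
  clear Hc; induction d as [|d IH].
  - apply continuous_ext with (fun _ => c 0%nat).
    { intros y; rewrite sum_O; simpl; ring. }
    apply continuous_const.
  - apply continuous_ext with
      (fun x => plus (sum_n (fun k => c k * x ^ k) d) (c (S d) * x ^ (S d))).
    { intros y; now rewrite sum_Sn. }
    apply (continuous_plus (V := R_NormedModule)); [exact IH|].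
    apply ex_derive_continuous; auto_derive; auto.
Qed.

Lemma poly_ex_RInt (f : R -> R) (a b : R) : is_polynomial f -> ex_RInt f a b.
Proof.
  intros Hf; apply (ex_RInt_continuous (V := R_CompleteNormedModule)).
  intros z _; now apply poly_continuous.
Qed.

Lemma is_derive_sum_pow (c : nat -> R) (d : nat) (x : R) :
  is_derive (fun x => sum_n (fun k => c k * x ^ k) (S d)) x
            (sum_n (fun k => INR (S k) * c (S k) * x ^ k) d).
Proof.
  induction d as [|d IH].
  - apply is_derive_ext with (fun x => c 0%nat + c 1%nat * x).
    { intros y; rewrite sum_Sn, sum_O; unfold plus; simpl; ring. }
    rewrite sum_O; auto_derive; auto; simpl; ring.
  - apply is_derive_ext with
      (fun x => plus (sum_n (fun k => c k * x ^ k) (S d)) (c (S (S d)) * x ^ (S (S d)))).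
    { intros y; symmetry; apply sum_Sn. }
    rewrite (sum_Sn _ d).
    apply (is_derive_plus (V := R_NormedModule)); [exact IH|].
    auto_derive; auto; rewrite S_INR; simpl; ring.
Qed.

Lemma eq_of_derive (f g : R -> R) (h : R -> R) :
  (forall x, is_derive f x (h x)) -> (forall x, is_derive g x (h x)) ->
  f 0 = g 0 -> forall x, f x = g x.
Proof.
  intros Hf Hg H0 x.
  destruct (MVT_gen (fun y => f y - g y) 0 x (fun _ => 0)) as [y [_ Hy]].
  - intros y _; replace 0 with (minus (h y) (h y)) by (unfold minus, plus, opp; simpl; ring).
    now apply (is_derive_minus (V := R_NormedModule)).
  - intros y _; apply continuity_pt_filterlim.
    apply (continuous_minus (V := R_NormedModule)); apply ex_derive_continuous;
      eexists; auto.
  - lra.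
Qed.

Lemma poly_primitive (f : R -> R) : is_polynomial f ->
  is_polynomial (fun x => RInt f 0 x).
Proof.
  intros Hf; pose proof Hf as [d [c Hc]].
  exists (S d), (fun k => match k with O => 0 | S j => c j / INR (S j) end).
  apply (eq_of_derive _ _ f).
  - intros x; apply (is_derive_RInt (V := R_NormedModule) _ _ 0).
    + apply filter_forall; intros y; apply (RInt_correct (V := R_CompleteNormedModule)).
      now apply poly_ex_RInt.
    + now apply poly_continuous.
  - intros x; rewrite Hc.
    rewrite (sum_n_ext _ (fun k => INR (S k) * (c k / INR (S k)) * x ^ k)).
    + apply (is_derive_sum_pow (fun k => match k with O => 0 | S j => c j / INR (S j) end)).
    + intros k; rewrite S_INR; pose proof (pos_INR k).
      change (c k * x ^ k = (INR k + 1) * (c k / (INR k + 1)) * x ^ k).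
      field; lra.
  - rewrite RInt_point; unfold zero; simpl.
    rewrite (sum_n_ext _ (fun _ => 0)).
    + now rewrite sum_n_const, Rmult_0_r.
    + intros [|k]; simpl; ring.
Qed.

Lemma poly_sub_const (f : R -> R) (a e : R) :
  is_polynomial f -> is_polynomial (fun x => a * (f x - e)).
Proof.
  intros [d [c Hc]].
  exists d, (fun k => a * (c k - match k with O => e | _ => 0 end)).
  intros x; rewrite Hc; clear Hc.
  induction d as [|d IH].
  - rewrite !sum_O; simpl; ring.
  - rewrite !sum_Sn, <- IH; unfold plus; simpl; ring.
Qed.

Lemma is_bernoulli_polynomials_ex : exists B, is_bernoulli_polynomials B.
Proof.
  pose (B := fix B (n : nat) : R -> R := match n with
    | O => fun _ => 1
    | S m => fun x => INR (S m) *
        (RInt (B m) 0 x - RInt (fun t => RInt (B m) 0 t) 0 1) end).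
  assert (P : forall n, is_polynomial (B n)).
  { induction n as [|n IH].
    - exists 0%nat, (fun _ => 1); intros x; rewrite sum_O; simpl; ring.
    - apply poly_sub_const; now apply poly_primitive. }
  assert (D : forall n x, is_derive (B (S n)) x (INR (S n) * B n x)).
  { intros n x.
    apply (is_derive_ext (fun x => scal (INR (S n))
      (minus (RInt (B n) 0 x) (RInt (fun t => RInt (B n) 0 t) 0 1)))).
    { reflexivity. }
    apply (is_derive_scal (fun x => minus (RInt (B n) 0 x) (RInt (fun t => RInt (B n) 0 t) 0 1))).
    replace (B n x) with (minus (B n x) 0) by (unfold minus, plus, opp; simpl; ring).
    apply (is_derive_minus (V := R_NormedModule)).
    - apply (is_derive_RInt (V := R_NormedModule) _ _ 0).
      + apply filter_forall; intros y; apply (RInt_correct (V := R_CompleteNormedModule)).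
        now apply poly_ex_RInt.
      + now apply poly_continuous.
    - apply (is_derive_const (V := R_NormedModule)). }
  assert (I : forall n, is_RInt (B (S n)) 0 1 0).
  { intros n.
    set (e := RInt (fun t => RInt (B n) 0 t) 0 1).
    replace 0 with (scal (INR (S n)) (minus e (scal (1 - 0) e))) at 2
      by (unfold scal, minus, plus, opp; simpl; unfold mult; simpl; ring).
    apply (is_RInt_scal (V := R_NormedModule)
             (fun x => minus (RInt (B n) 0 x) e)).
    apply (is_RInt_minus (V := R_NormedModule)).
    - apply (RInt_correct (V := R_CompleteNormedModule)).
      apply poly_ex_RInt; now apply poly_primitive.
    - apply (is_RInt_const (V := R_NormedModule)). }
  exists B; split; [exact P|]; split; [reflexivity|].
  intros n Hn; destruct n as [|n]; [lia|clear Hn]; split; [|apply I].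
  replace (S n - 1)%nat with n by lia.
  induction n as [|n IH].
  - intros x; simpl. rewrite !RInt_const; unfold scal; simpl; unfold mult; simpl; ring.
  - apply (eq_of_derive _ _ (fun x => INR (S (S n)) * (INR (S n) * x ^ n))).
    + intros x; rewrite <- IH.
      replace (INR (S (S n)) * (B (S n) (x + 1) - B (S n) x)) with
        (minus (scal 1 (INR (S (S n)) * B (S n) (x + 1))) (INR (S (S n)) * B (S n) x))
        by (unfold scal, minus, plus, opp; simpl; unfold mult; simpl; ring).
      apply (is_derive_minus (V := R_NormedModule)); [|apply D].
      apply (is_derive_comp (V := R_NormedModule) (B (S (S n))) (fun x => x + 1)); [apply D|].
      auto_derive; auto.
    + intros x; auto_derive; auto. change (match n with 0%nat => 1 | S _ => INR n + 1 end) with (INR (S n)); simpl pred; rewrite !S_INR; ring.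
    + pose proof (I n) as In; apply (is_RInt_unique (V := R_CompleteNormedModule)) in In.
      change (B (S (S n))) with (fun x => INR (S (S n)) *
        (RInt (B (S n)) 0 x - RInt (fun t => RInt (B (S n)) 0 t) 0 1)).
      cbv beta. rewrite Rplus_0_l, RInt_point. rewrite In.
      unfold zero; simpl; ring.
Qed.

Lemma poly_periodic_const (d : nat) (f : R -> R) : poly_of_degree_le d f ->
  (forall x, f (x + 1) = f x) -> forall x, f x = f 0.
Proof.
  revert f; induction d as [|d IH]; intros f [c Hc] Hp x.
  - rewrite !Hc, !sum_O; simpl; ring.
  - pose (g := fun x => sum_n (fun k => INR (S k) * c (S k) * x ^ k) d).
    assert (D : forall x, is_derive f x (g x)).
    { intros y; apply (is_derive_ext (fun x => sum_n (fun k => c k * x ^ k) (S d))).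
      - intros t; now rewrite Hc.
      - apply is_derive_sum_pow. }
    assert (G : forall x, g x = g 0).
    { apply IH; [now exists (fun k => INR (S k) * c (S k))|].
      intros y; apply eq_trans with (Derive f y); [|now apply is_derive_unique].
      symmetry; apply is_derive_unique.
      apply (is_derive_ext (fun y => f (y + 1))); [intros t; apply Hp|].
      replace (g (y + 1)) with (scal 1 (g (y + 1)))
        by (unfold scal; simpl; unfold mult; simpl; ring).
      apply (is_derive_comp (V := R_NormedModule) f (fun x => x + 1)); [apply D|].
      auto_derive; auto. }
    assert (L : forall x, f x = g 0 * x + f 0).
    { apply (eq_of_derive _ _ g); [exact D| |ring].
      intros y; rewrite (G y); auto_derive; auto; ring. }
    pose proof (Hp 0) as H0; rewrite (L (0 + 1)) in H0.
    rewrite (L x); replace (g 0) with 0 by lra; ring.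
Qed.

Lemma is_bernoulli_polynomials_unique (B B' : nat -> R -> R) :
  is_bernoulli_polynomials B -> is_bernoulli_polynomials B' ->
  forall n x, B n x = B' n x.
Proof.
  intros [P [Z H]] [P' [Z' H']] [|n] x; [now rewrite Z, Z'|].
  destruct (H (S n)) as [E I]; [lia|]. destruct (H' (S n)) as [E' I']; [lia|].
  destruct (P (S n)) as [d [c Hc]]; destruct (P' (S n)) as [d' [c' Hc']].
  pose (f := fun x => B (S n) x - B' (S n) x).
  assert (K : forall x, f x = f 0).
  { assert (ext : forall (a : nat -> R) i j y, sum_n (fun k => a k * y ^ k) i =
      sum_n (fun k => (if Nat.leb k i then a k else 0) * y ^ k) (i + j)).
    { intros a i j y; induction j as [|j IHj].
      - rewrite Nat.add_0_r; apply sum_n_ext_loc; intros k Hk.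
        now rewrite (proj2 (Nat.leb_le k i) Hk).
      - rewrite Nat.add_succ_r, sum_Sn, <- IHj.
        rewrite (proj2 (Nat.leb_gt (S (i + j)) i)) by lia.
        rewrite Rmult_0_l; symmetry; apply Rplus_0_r. }
    apply (poly_periodic_const (d + d')).
    - exists (fun k => (if Nat.leb k d then c k else 0) - (if Nat.leb k d' then c' k else 0)).
      intros y; unfold f; rewrite Hc, Hc', (ext c d d'), (ext c' d' d).
      rewrite (Nat.add_comm d' d).
      induction (d + d')%nat as [|m IHm].
      + rewrite !sum_O; ring.
      + rewrite !sum_Sn, <- IHm; unfold plus; simpl; ring.
    - intros y; unfold f; specialize (E y); specialize (E' y); lra. }
  assert (F : is_RInt f 0 1 (minus 0 0)) by now apply (is_RInt_minus (V := R_NormedModule)).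
  assert (F' : is_RInt f 0 1 (scal (1 - 0) (f 0))).
  { apply (is_RInt_ext (V := R_NormedModule) (fun _ => f 0)); [intros; symmetry; apply K|].
    apply (is_RInt_const (V := R_NormedModule)). }
  apply (is_RInt_unique (V := R_CompleteNormedModule)) in F, F'.
  rewrite F in F'; unfold scal, minus, plus, opp in F'; simpl in F'; unfold mult in F'; simpl in F'.
  specialize (K x); unfold f in *; lra.
Qed.

(* Main.v *)
(* Summing the partial fractions [pi / sin (pi x) = 1/x + sum_n (-1)^n (1/(x+n) + 1/(x-n))] over
   x = k/p gives, with H the harmonic numbers,
   [pi I_p / p = lim (4 sum_(n <= N) (-1)^(n-1) (H (n p) - 1 / (2 n p)) + boundary terms)].
   Insert the Euler-Maclaurin expansion of H (n p). Its logarithms contribute Wallis' product,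
   its terms in (n p)^(-2k) contribute the alternating zeta values at 2k (the second Bernoulli
   factor), and its remainder r_m satisfies
   [r_m j - r_m (j+1) = int_0^1 (B_(2m+2) t - b_(2m+2)) / (j+t)^(2m+3) dt],
   which has the sign of (-1)^(m+1). Hence (-1)^(m+1) r_m decreases, so the alternating sum of the
   remainders has a definite sign, and this sign alternates with m.
   Partial fractions and zeta values are both cosine series evaluated at 0: of cos (a x) and of
   B_(2k) (1/2 + x / (2 pi)). *)
Require Import Defs.
From Stdlib Require Import Reals Factorial Lra Lia.
From Coquelicot Require Import Coquelicot.
Open Scope R_scope.

(** * Bernoulli polynomials *)

(** The Bernoulli polynomials are given only by a characterization, so the derivative rule, the
    reflection and the duplication formula are each obtained by checking that a transformed family
    satisfies it again. The series behind the two bounds diverges for every p, since b_(2k)^2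
    outgrows (2k)!; so m stays fixed and an exact remainder carries the argument. Letting N tend to
    infinity would turn strict inequalities into weak ones. What survives is a gap independent of N:
    the difference of the remainders at p and 2p bounds every alternating sum of even length from
    below. Only even N are used: the signs (-1)^n then sum to zero, so ln p + gamma leaves the
    alternating sum and enters only through the two boundary harmonic numbers H (N p) and H ((N+1)
    p). The centre 1/2 of the second cosine series turns zeta values into alternating ones, and
    B_(2k) (1/2) = (2^(1-2k) - 1) b_(2k) is the origin of the factor 2^(2k) - 2. *)

Lemma poly_of_degree_le_mono (d d' : nat) (f : R -> R) :
  (d <= d')%nat -> poly_of_degree_le d f -> poly_of_degree_le d' f.
Proof.
  intros Hd; induction Hd as [|d' Hd IH]; [auto|]; intros Hf.
  destruct (IH Hf) as [c Hc].
  exists (fun k => if Nat.leb k d' then c k else 0); intros x.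
  rewrite Hc, sum_Sn, (proj2 (Nat.leb_gt (S d') d')) by lia.
  rewrite Rmult_0_l; unfold plus; simpl; rewrite Rplus_0_r.
  apply sum_n_ext_loc; intros k Hk; now rewrite (proj2 (Nat.leb_le k d') Hk).
Qed.

Lemma is_polynomial_ext (f g : R -> R) :
  (forall x, f x = g x) -> is_polynomial f -> is_polynomial g.
Proof. intros E [d [c Hc]]; exists d, c; intros x; now rewrite <- E. Qed.

Lemma is_polynomial_const (a : R) : is_polynomial (fun _ => a).
Proof. exists 0%nat, (fun _ => a); intros x; rewrite sum_O; simpl; ring. Qed.

Lemma is_polynomial_plus (f g : R -> R) :
  is_polynomial f -> is_polynomial g -> is_polynomial (fun x => f x + g x).
Proof.
  intros [d Hf] [d' Hg].
  apply (poly_of_degree_le_mono d (max d d')) in Hf; [|lia].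
  apply (poly_of_degree_le_mono d' (max d d')) in Hg; [|lia].
  destruct Hf as [c Hc], Hg as [c' Hc'].
  exists (max d d'), (fun k => c k + c' k); intros x; rewrite Hc, Hc'.
  symmetry; etransitivity; [|apply (sum_n_plus (G := R_AbelianMonoid))].
  apply sum_n_ext; intros k; unfold plus; simpl; ring.
Qed.

Lemma is_polynomial_scal (a : R) (f : R -> R) :
  is_polynomial f -> is_polynomial (fun x => a * f x).
Proof.
  intros [d [c Hc]]; exists d, (fun k => a * c k); intros x; rewrite Hc.
  rewrite <- (sum_n_mult_l (K := R_Ring)); apply sum_n_ext; intros k.
  unfold mult; simpl; ring.
Qed.

Lemma is_polynomial_mul_X (f : R -> R) :
  is_polynomial f -> is_polynomial (fun x => x * f x).
Proof.
  intros [d [c Hc]].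
  exists (S d), (fun k => match k with O => 0 | S j => c j end); intros x; rewrite Hc.
  clear Hc; induction d as [|d IH].
  - rewrite sum_Sn, !sum_O; unfold plus; simpl; ring.
  - rewrite sum_Sn, (sum_Sn _ (S d)), <- IH; unfold plus; simpl; ring.
Qed.

Lemma is_polynomial_comp_affine (f : R -> R) (a b : R) :
  is_polynomial f -> is_polynomial (fun x => f (a * x + b)).
Proof.
  intros [d [c Hc]].
  assert (P : forall k, is_polynomial (fun x => (a * x + b) ^ k)).
  { induction k as [|k IH]; [apply (is_polynomial_const 1)|].
    apply is_polynomial_ext with
      (fun x => a * (x * (a * x + b) ^ k) + b * (a * x + b) ^ k).
    { intros x; simpl; ring. }
    apply is_polynomial_plus; apply is_polynomial_scal; [|exact IH].
    now apply (is_polynomial_mul_X (fun x => (a * x + b) ^ k)). }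
  apply is_polynomial_ext with (fun x => sum_n (fun k => c k * (a * x + b) ^ k) d).
  { intros x; now rewrite Hc. }
  clear Hc; induction d as [|d IH].
  - apply is_polynomial_ext with (fun _ => c 0%nat); [|apply is_polynomial_const].
    intros x; rewrite sum_O; simpl; ring.
  - apply is_polynomial_ext with (fun x => sum_n (fun k => c k * (a * x + b) ^ k) d
      + c (S d) * (a * x + b) ^ S d).
    { intros x; now rewrite sum_Sn. }
    apply is_polynomial_plus; [exact IH|now apply is_polynomial_scal].
Qed.

Lemma is_polynomial_derive (f : R -> R) : is_polynomial f ->
  exists g, is_polynomial g /\ forall x, is_derive f x (g x).
Proof.
  intros [d Hd]; apply (poly_of_degree_le_mono d (S d)) in Hd; [|lia].
  destruct Hd as [c Hc].
  exists (fun x => sum_n (fun k => INR (S k) * c (S k) * x ^ k) d); split.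
  - now exists d, (fun k => INR (S k) * c (S k)).
  - intros x; apply (is_derive_ext (fun x => sum_n (fun k => c k * x ^ k) (S d))).
    + intros t; now rewrite Hc.
    + apply is_derive_sum_pow.
Qed.

Lemma is_derive_comp_affine (f : R -> R) (a b x l : R) :
  is_derive f (a * x + b) l -> is_derive (fun x => f (a * x + b)) x (a * l).
Proof.
  intros Hf; apply (is_derive_comp (V := R_NormedModule) f (fun x => a * x + b)); auto.
  auto_derive; auto; ring.
Qed.

Lemma is_RInt_primitive (f F : R -> R) (a b : R) :
  (forall x, is_derive F x (f x)) -> (forall x, continuous f x) ->
  is_RInt f a b (F b - F a).
Proof. intros; apply (is_RInt_derive (V := R_CompleteNormedModule) F f); auto. Qed.

Section Bernoulli.

Variable B : nat -> R -> R.
Hypothesis HB : is_bernoulli_polynomials B.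

Lemma bernoulli_poly (n : nat) : is_polynomial (B n).
Proof. apply HB. Qed.

Lemma bernoulli_0 (x : R) : B 0 x = 1.
Proof. apply HB. Qed.

Lemma bernoulli_shift (n : nat) (x : R) : B (S n) (x + 1) - B (S n) x = INR (S n) * x ^ n.
Proof.
  destruct HB as [_ [_ H]]; destruct (H (S n)) as [E _]; [lia|].
  rewrite E; simpl (S n - 1)%nat; now rewrite Nat.sub_0_r.
Qed.

Lemma bernoulli_RInt (n : nat) : is_RInt (B (S n)) 0 1 0.
Proof. destruct HB as [_ [_ H]]; apply (H (S n)); lia. Qed.

(** Uniqueness applied to the family B_(n+1)' / (n+1): differentiating the shift equation gives its
    difference equation, and the integral of B_(n+1)' over [0, 1] is B_(n+1) 1 - B_(n+1) 0, which is
    zero for n >= 1. *)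
Lemma bernoulli_derive (n : nat) (x : R) : is_derive (B (S n)) x (INR (S n) * B n x).
Proof.
  assert (G : forall n, exists g, is_polynomial g /\ forall x, is_derive (B (S n)) x (g x))
    by (intros m; apply is_polynomial_derive, bernoulli_poly).
  assert (GD : forall n x, is_derive (B (S n)) x (Derive (B (S n)) x)).
  { intros m y; apply Derive_correct; destruct (G m) as [g [_ Hg]]; eexists; apply Hg. }
  assert (GP : forall n, is_polynomial (Derive (B (S n)))).
  { intros m; destruct (G m) as [g [Pg Hg]]; apply (is_polynomial_ext g); [|exact Pg].
    intros y; symmetry; now apply is_derive_unique. }
  assert (GS : forall n x, Derive (B (S n)) (x + 1) - Derive (B (S n)) x
                           = INR (S n) * (INR n * x ^ (n - 1))).
  { intros m y; transitivity (Derive (fun y => B (S m) (1 * y + 1) - B (S m) y) y).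
    - symmetry; apply is_derive_unique.
      replace (y + 1) with (1 * y + 1) by ring.
      replace (Derive (B (S m)) (1 * y + 1)) with (1 * Derive (B (S m)) (1 * y + 1)) by ring.
      apply (is_derive_minus (V := R_NormedModule)); [|apply GD].
      apply is_derive_comp_affine, GD.
    - rewrite (Derive_ext _ (fun y => INR (S m) * y ^ m)).
      + apply is_derive_unique; generalize (INR (S m)); intros c; auto_derive; auto.
        replace (pred m) with (m - 1)%nat by lia; ring.
      + intros t; rewrite Rmult_1_l; apply bernoulli_shift. }
  assert (GI : forall n, is_RInt (Derive (B (S n))) 0 1 (B (S n) 1 - B (S n) 0)).
  { intros m; apply is_RInt_primitive; [apply GD|].
    intros y; now apply poly_continuous. }
  (* The derivative of [B 1] has period 1, hence is constant, and its mean over [0, 1] is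
     [B 1 1 - B 1 0], that is 1. *)
  assert (C1 : forall x, Derive (B 1) x = 1).
  { assert (K : forall x, Derive (B 1) x = Derive (B 1) 0).
    { destruct (GP 0%nat) as [d Hd]; apply (poly_periodic_const d); [exact Hd|].
      intros y; pose proof (GS 0%nat y) as E; simpl in E; lra. }
    assert (E := GI 0%nat).
    pose proof (bernoulli_shift 0 0) as E1; rewrite Rplus_0_l in E1; rewrite E1 in E.
    assert (E2 : is_RInt (Derive (B 1)) 0 1 (scal (1 - 0) (Derive (B 1) 0))).
    { apply (is_RInt_ext (V := R_NormedModule) (fun _ => Derive (B 1) 0)).
      - intros; symmetry; apply K.
      - apply (is_RInt_const (V := R_NormedModule)). }
    apply (is_RInt_unique (V := R_CompleteNormedModule)) in E, E2.
    rewrite E in E2; unfold scal in E2; simpl in E2; unfold mult in E2; simpl in E2.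
    intros y; rewrite K; lra. }
  assert (HC : is_bernoulli_polynomials (fun n x => / INR (S n) * Derive (B (S n)) x)).
  { split; [|split].
    - intros m; now apply is_polynomial_scal.
    - intros y; rewrite C1; simpl; field.
    - intros m Hm; pose proof (not_0_INR (S m)); split.
      + intros y; rewrite <- Rmult_minus_distr_l, GS; field; auto.
      + replace 0 with (scal (/ INR (S m)) 0) at 2
          by (unfold scal; simpl; unfold mult; simpl; ring).
        apply (is_RInt_scal (V := R_NormedModule)).
        replace 0 with (B (S m) 1 - B (S m) 0) at 2; [apply GI|].
        pose proof (bernoulli_shift m 0) as E; rewrite Rplus_0_l in E; rewrite E.
        rewrite pow_i; [ring|lia]. }
  rewrite (is_bernoulli_polynomials_unique _ _ HB HC n x).
  pose proof (not_0_INR (S n)).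
  replace (INR (S n) * (/ INR (S n) * Derive (B (S n)) x)) with (Derive (B (S n)) x)
    by (field; auto).
  apply GD.
Qed.

Lemma bernoulli_continuous (n : nat) (x : R) : continuous (B n) x.
Proof. apply poly_continuous, bernoulli_poly. Qed.

Lemma is_RInt_bernoulli (n : nat) (a b : R) :
  is_RInt (B n) a b (B (S n) b / INR (S n) - B (S n) a / INR (S n)).
Proof.
  apply (is_RInt_primitive _ (fun x => B (S n) x / INR (S n))).
  - intros x; pose proof (not_0_INR (S n)).
    apply (is_derive_ext (fun x => scal (/ INR (S n)) (B (S n) x))).
    { intros t; unfold scal; simpl; unfold mult; simpl; unfold Rdiv; ring. }
    replace (B n x) with (scal (/ INR (S n)) (INR (S n) * B n x))
      by (unfold scal; simpl; unfold mult; simpl; field; auto).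
    apply (is_derive_scal (B (S n))), bernoulli_derive.
  - apply bernoulli_continuous.
Qed.

Lemma bernoulli_0_1 (n : nat) : B (S (S n)) 1 = B (S (S n)) 0.
Proof.
  pose proof (bernoulli_shift (S n) 0) as E; rewrite Rplus_0_l, pow_i in E by lia; lra.
Qed.

(** Uniqueness again: the family (-1)^n B_n (1 - x) satisfies the characterization. *)
Lemma bernoulli_symm (n : nat) (x : R) : B n (1 - x) = (-1) ^ n * B n x.
Proof.
  assert (HC : is_bernoulli_polynomials (fun n x => (-1) ^ n * B n ((-1) * x + 1))).
  { split; [|split].
    - intros m; apply (is_polynomial_scal _ (fun x => B m (-1 * x + 1))).
      apply (is_polynomial_comp_affine (B m)), bernoulli_poly.
    - intros y; rewrite bernoulli_0; simpl; ring.
    - intros [|m] Hm; [lia|]; split.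
      + intros y; rewrite <- Rmult_minus_distr_l.
        replace (-1 * (y + 1) + 1) with (- y) by ring.
        replace (-1 * y + 1) with (- y + 1) by ring.
        replace (B (S m) (- y) - B (S m) (- y + 1)) with
          (- (INR (S m) * (- y) ^ m)) by (rewrite <- bernoulli_shift; ring).
        replace (S m - 1)%nat with m by lia.
        replace (- y) with (-1 * y) by ring; rewrite Rpow_mult_distr.
        transitivity (INR (S m) * y ^ m * ((-1) ^ m * (-1) ^ m)); [simpl; ring|].
        rewrite <- Rpow_mult_distr.
        replace (-1 * -1) with 1 by ring; rewrite pow1; ring.
      + replace 0 with (scal ((-1) ^ S m * (-1)) 0) at 2
          by (unfold scal; simpl; unfold mult; simpl; ring).
        apply (is_RInt_ext (V := R_NormedModule)
          (fun y => scal ((-1) ^ S m * (-1)) (scal (-1) (B (S m) (-1 * y + 1))))).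
        { intros y _; unfold scal; simpl; unfold mult; simpl; ring. }
        apply (is_RInt_scal (V := R_NormedModule)).
        apply (is_RInt_comp_lin (V := R_NormedModule)).
        replace (-1 * 0 + 1) with 1 by ring; replace (-1 * 1 + 1) with 0 by ring.
        replace 0 with (opp 0) at 2 by (unfold opp; simpl; ring).
        apply (is_RInt_swap (V := R_NormedModule)), bernoulli_RInt. }
  rewrite (is_bernoulli_polynomials_unique _ _ HB HC n (1 - x)).
  now replace (-1 * (1 - x) + 1) with x by ring.
Qed.

(** This is the duplication formula B_n x = 2^(n-1) (B_n (x/2) + B_n ((x+1)/2)) at x = 0; its
    right-hand side satisfies the characterization. The factor is written [2 ^ n / 2] so that it is
    also correct for n = 0. *)
Lemma bernoulli_half (n : nat) : B n (/ 2) = (2 / 2 ^ n - 1) * B n 0.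
Proof.
  assert (HC : is_bernoulli_polynomials
    (fun n x => 2 ^ n / 2 * (B n (/ 2 * x + 0) + B n (/ 2 * x + / 2)))).
  { split; [|split].
    - intros m; apply is_polynomial_scal, is_polynomial_plus;
        apply (is_polynomial_comp_affine (B m)), bernoulli_poly.
    - intros y; rewrite !bernoulli_0; simpl; field.
    - intros [|m] Hm; [lia|]; split.
      + intros y; rewrite <- Rmult_minus_distr_l.
        replace (/ 2 * (y + 1) + 0) with (/ 2 * y + / 2) by field.
        replace (/ 2 * (y + 1) + / 2) with (/ 2 * y + 0 + 1) by field.
        replace (S m - 1)%nat with m by lia.
        transitivity (2 ^ m * (INR (S m) * (/ 2 * y + 0) ^ m)).
        { rewrite <- bernoulli_shift; simpl; field. }
        rewrite Rplus_0_r, Rpow_mult_distr, pow_inv; field; apply pow_nonzero; lra.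
      (* After substitution the two summands integrate [B (S m)] over the two halves of [0, 1]; the
         values at 1/2 cancel. *)
      + replace 0 with (scal (2 ^ S m) (plus
            (B (S (S m)) (/ 2) / INR (S (S m)) - B (S (S m)) 0 / INR (S (S m)))
            (B (S (S m)) 1 / INR (S (S m)) - B (S (S m)) (/ 2) / INR (S (S m))))) at 2.
        2:{ unfold scal, plus; simpl; unfold mult; simpl; rewrite bernoulli_0_1; ring. }
        apply (is_RInt_ext (V := R_NormedModule) (fun y => scal (2 ^ S m) (plus
           (scal (/ 2) (B (S m) (/ 2 * y + 0))) (scal (/ 2) (B (S m) (/ 2 * y + / 2)))))).
        { intros y _; unfold scal, plus; simpl; unfold mult; simpl; field. }
        apply (is_RInt_scal (V := R_NormedModule)).
        apply (is_RInt_plus (V := R_NormedModule));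
          apply (is_RInt_comp_lin (V := R_NormedModule)).
        * replace (/ 2 * 0 + 0) with 0 by ring; replace (/ 2 * 1 + 0) with (/ 2) by ring.
          apply is_RInt_bernoulli.
        * replace (/ 2 * 0 + / 2) with (/ 2) by ring.
          replace (/ 2 * 1 + / 2) with 1 by field.
          apply is_RInt_bernoulli. }
  pose proof (is_bernoulli_polynomials_unique _ _ HB HC n 0) as E; cbv beta in E.
  rewrite Rmult_0_r, Rplus_0_l, Rplus_0_l in E.
  assert (P : 2 ^ n <> 0) by (apply pow_nonzero; lra).
  assert (B n 0 * (2 / 2 ^ n) = B n 0 + B n (/ 2)); [|lra].
  rewrite E at 1; field; auto.
Qed.

Lemma pow_m1_odd (k : nat) : (-1) ^ (2 * k + 1) = -1.
Proof. rewrite Nat.add_1_r; apply pow_1_odd. Qed.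

Lemma bernoulli_odd_half (k : nat) : B (2 * k + 1) (/ 2) = 0.
Proof.
  pose proof (bernoulli_symm (2 * k + 1) (/ 2)) as E.
  rewrite pow_m1_odd in E; replace (1 - / 2) with (/ 2) in E by field; lra.
Qed.

(** Reflection at 0 combined with the equality of the values at 0 and 1. The index starts at 3
    because [B 1 0] is [- / 2]. *)
Lemma bernoulli_odd_0 (k : nat) : B (2 * k + 3) 0 = 0.
Proof.
  pose proof (bernoulli_symm (2 * S k + 1) 0) as E.
  rewrite pow_m1_odd, Rminus_0_r in E.
  replace (2 * S k + 1)%nat with (S (S (2 * k + 1))) in E by lia.
  rewrite bernoulli_0_1 in E.
  replace (2 * k + 3)%nat with (S (S (2 * k + 1))) by lia; lra.
Qed.

Lemma bernoulli_1 : B 1 0 = - / 2 /\ B 1 1 = / 2.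
Proof.
  pose proof (bernoulli_symm 1 0) as E; rewrite Rminus_0_r in E.
  pose proof (bernoulli_shift 0 0) as E'; rewrite Rplus_0_l in E'; simpl in *; lra.
Qed.

(** * Signs of the Bernoulli polynomials on the unit interval *)

Lemma MVT_open (f g : R -> R) (a b : R) : a < b -> (forall x, is_derive f x (g x)) ->
  exists c, a < c < b /\ f b - f a = g c * (b - a).
Proof.
  intros Hab Hf.
  destruct (MVT_cor2 f g a b Hab) as [c [E Hc]].
  - intros x _; now apply is_derive_Reals.
  - now exists c.
Qed.

(** The two claims feed each other. The sign of B_(2m+1) is that of the derivative of B_(2m+2). In
    turn, monotonicity of (-1)^(m+1) B_(2m+2) makes (-1)^(m+1) B_(2m+3) strictly convex on [0, 1/2];
    since it vanishes at both ends, it is negative in between. *)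
Lemma bernoulli_odd_sign_even_mono (m : nat) :
  (forall x, 0 < x < / 2 -> 0 < (-1) ^ (m + 1) * B (2 * m + 1) x) /\
  (forall x y, 0 <= x -> x < y -> y <= / 2 ->
     (-1) ^ (m + 1) * B (2 * m + 2) x < (-1) ^ (m + 1) * B (2 * m + 2) y).
Proof.
  assert (Step : forall m,
    (forall x, 0 < x < / 2 -> 0 < (-1) ^ (m + 1) * B (2 * m + 1) x) ->
    (forall x y, 0 <= x -> x < y -> y <= / 2 ->
     (-1) ^ (m + 1) * B (2 * m + 2) x < (-1) ^ (m + 1) * B (2 * m + 2) y)).
  { clear m; intros m H x y Hx Hxy Hy.
    replace (2 * m + 2)%nat with (S (2 * m + 1)) by lia.
    destruct (MVT_open _ _ x y Hxy (bernoulli_derive (2 * m + 1))) as [c [Hc E]].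
    assert (0 < (-1) ^ (m + 1) * (INR (S (2 * m + 1)) * B (2 * m + 1) c * (y - x))); [|nra].
    replace ((-1) ^ (m + 1) * (INR (S (2 * m + 1)) * B (2 * m + 1) c * (y - x))) with
      (INR (S (2 * m + 1)) * (y - x) * ((-1) ^ (m + 1) * B (2 * m + 1) c)) by ring.
    apply Rmult_lt_0_compat; [|apply H; lra].
    apply Rmult_lt_0_compat; [apply lt_0_INR; lia|lra]. }
  induction m as [|m [IH1 IH2]].
  - assert (H : forall x, 0 < x < / 2 -> 0 < (-1) ^ (0 + 1) * B (2 * 0 + 1) x); [|auto].
    intros x Hx; simpl.
    destruct (MVT_open _ _ 0 x (proj1 Hx) (bernoulli_derive 0)) as [c [_ E]].
    rewrite bernoulli_0, (proj1 bernoulli_1) in E; simpl in E; lra.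
  - assert (H : forall x, 0 < x < / 2 -> 0 < (-1) ^ (S m + 1) * B (2 * S m + 1) x); [|auto].
    intros x Hx; replace (2 * S m + 1)%nat with (S (2 * m + 2)) by lia.
    destruct (MVT_open _ _ 0 x (proj1 Hx) (bernoulli_derive (2 * m + 2))) as [c [Hc E]].
    destruct (MVT_open _ _ x (/ 2) (proj2 Hx) (bernoulli_derive (2 * m + 2))) as [c' [Hc' E']].
    pose proof (bernoulli_odd_0 m) as Z; pose proof (bernoulli_odd_half (S m)) as Z'.
    replace (2 * m + 3)%nat with (S (2 * m + 2)) in Z by lia.
    replace (2 * S m + 1)%nat with (S (2 * m + 2)) in Z' by lia.
    rewrite Z in E; rewrite Z' in E'.
    assert (L : (-1) ^ (m + 1) * B (2 * m + 2) c < (-1) ^ (m + 1) * B (2 * m + 2) c')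
      by (apply IH2; lra).
    change ((-1) ^ (S m + 1)) with (-1 * (-1) ^ (m + 1)).
    set (s := (-1) ^ (m + 1)) in *; set (u := B (2 * m + 2) c) in *.
    set (v := B (2 * m + 2) c') in *; set (w := B (S (2 * m + 2)) x) in *.
    assert (Hn : 0 < INR (S (2 * m + 2))) by (apply lt_0_INR; lia).
    set (n := INR (S (2 * m + 2))) in *.
    (* Were [s * w] nonnegative, the mean slope on [0, x] would be nonnegative, so the larger mean
       slope on [x, 1/2] would be positive, although the function has to return to 0. *)
    apply Rnot_le_lt; intros Hle.
    assert (A1 : s * w = (s * u) * (n * x)) by (replace w with (w - 0) by ring; rewrite E; ring).
    assert (A2 : - (s * w) = (s * v) * (n * (/ 2 - x)))
      by (replace (- (s * w)) with (s * (0 - w)) by ring; rewrite E'; ring).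
    assert (0 < n * x) by (apply Rmult_lt_0_compat; lra).
    assert (0 < n * (/ 2 - x)) by (apply Rmult_lt_0_compat; lra).
    assert (0 <= s * u) by (apply (Rmult_le_reg_r (n * x)); lra).
    assert (0 < (s * v) * (n * (/ 2 - x))) by (apply Rmult_lt_0_compat; lra).
    lra.
Qed.

(** Monotonicity settles (0, 1/2], and the reflection, which fixes polynomials of even index,
    carries the sign to the other half. *)
Lemma bernoulli_even_sign (m : nat) (x : R) : 0 < x < 1 ->
  0 < (-1) ^ (m + 1) * (B (2 * m + 2) x - B (2 * m + 2) 0).
Proof.
  intros Hx; destruct (bernoulli_odd_sign_even_mono m) as [_ H].
  assert (K : forall x, 0 < x <= / 2 ->
    0 < (-1) ^ (m + 1) * (B (2 * m + 2) x - B (2 * m + 2) 0)).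
  { intros y Hy; pose proof (H 0 y); lra. }
  destruct (Rle_lt_dec x (/ 2)); [apply K; lra|].
  replace (B (2 * m + 2) x) with (B (2 * m + 2) (1 - x)); [apply K; lra|].
  rewrite bernoulli_symm; replace (2 * m + 2)%nat with (2 * (m + 1))%nat by lia.
  rewrite pow_1_even; ring.
Qed.

End Bernoulli.

(** * Cosine series *)

(* Goals of [is_derive_ext] are equations in the carrier of a canonical structure. *)
Ltac change_eq_R := match goal with |- @eq _ ?a ?b => change (@eq R a b) end.
Ltac rring := change_eq_R; ring.

Lemma sum_n_m_1_0 (a : nat -> R) : sum_n_m a 1 0 = 0.
Proof. now rewrite sum_n_m_zero by lia. Qed.

Lemma sum_n_m_1_S (a : nat -> R) (n : nat) : sum_n_m a 1 (S n) = sum_n_m a 1 n + a (S n).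
Proof. now rewrite sum_n_Sm by lia. Qed.

Lemma sum_n_m_Rmult_l (c : R) (a : nat -> R) (n m : nat) :
  sum_n_m (fun k => c * a k) n m = c * sum_n_m a n m.
Proof. exact (sum_n_m_mult_l (K := R_Ring) c a n m). Qed.

Lemma is_derive_continuous (f : R -> R) (x l : R) : is_derive f x l -> continuous f x.
Proof. intros H; apply (ex_derive_continuous (V := R_NormedModule)); now exists l. Qed.

Lemma cos_INR_PI (n : nat) : cos (INR n * PI) = (-1) ^ n.
Proof.
  induction n as [|n IH]; [simpl; now rewrite Rmult_0_l, cos_0|].
  rewrite S_INR, Rmult_plus_distr_r, Rmult_1_l, neg_cos, IH; simpl; ring.
Qed.

Lemma sin_INR_PI (n : nat) : sin (INR n * PI) = 0.
Proof.
  induction n as [|n IH]; [simpl; now rewrite Rmult_0_l, sin_0|].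
  rewrite S_INR, Rmult_plus_distr_r, Rmult_1_l, neg_sin, IH; ring.
Qed.

(** The sum telescopes, because 2 sin (x/2) cos (n x) = sin ((n + 1/2) x) - sin ((n - 1/2) x). *)
Lemma dirichlet_kernel (N : nat) (x : R) :
  2 * sin (x / 2) * (/ 2 + sum_n_m (fun n => cos (INR n * x)) 1 N)
  = sin ((INR N + / 2) * x).
Proof.
  induction N as [|N IH].
  - rewrite sum_n_m_1_0; simpl; replace ((0 + / 2) * x) with (x / 2) by field; field.
  - rewrite sum_n_m_1_S.
    replace ((INR (S N) + / 2) * x) with (INR (S N) * x + x / 2) by field.
    rewrite sin_plus, <- Rplus_assoc, Rmult_plus_distr_l, IH.
    replace ((INR N + / 2) * x) with (INR (S N) * x - x / 2) by (rewrite S_INR; field).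
    rewrite sin_minus; ring.
Qed.

(** (PI - x) / 2 is the sum of the Fourier series of sin (n x) / n on (0, 2 PI), so this is its
    remainder after N terms. It is also the primitive of minus the Dirichlet kernel that vanishes at
    PI, which is how it is used. *)
Definition sawtooth_tail (N : nat) (x : R) : R :=
  (PI - x) / 2 - sum_n_m (fun n => sin (INR n * x) / INR n) 1 N.

Lemma is_derive_sawtooth_tail (N : nat) (x : R) :
  is_derive (sawtooth_tail N) x (- (/ 2 + sum_n_m (fun n => cos (INR n * x)) 1 N)).
Proof.
  unfold sawtooth_tail; induction N as [|N IH].
  - apply (is_derive_ext (fun x => (PI - x) / 2)).
    { intros t; rewrite sum_n_m_1_0; rring. }
    rewrite sum_n_m_1_0; auto_derive; auto; field.
  - apply (is_derive_ext (fun x => minus ((PI - x) / 2 -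
      sum_n_m (fun n => sin (INR n * x) / INR n) 1 N) (sin (INR (S N) * x) / INR (S N)))).
    { intros t; rewrite sum_n_m_1_S; unfold minus, plus, opp; simpl; rring. }
    rewrite sum_n_m_1_S.
    replace (- (/ 2 + (sum_n_m (fun n => cos (INR n * x)) 1 N + cos (INR (S N) * x))))
      with (minus (- (/ 2 + sum_n_m (fun n => cos (INR n * x)) 1 N)) (cos (INR (S N) * x)))
      by (unfold minus, plus, opp; simpl; ring).
    apply (is_derive_minus (V := R_NormedModule)); [exact IH|].
    pose proof (not_0_INR (S N)) as Hn; specialize (Hn ltac:(lia)).
    revert Hn; generalize (INR (S N)); intros c Hc; auto_derive; auto; field; auto.
Qed.

Lemma sin_half_pos (x : R) : 0 < x <= PI -> 0 < sin (x / 2).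
Proof. intros Hx; apply sin_gt_0; lra. Qed.

(* With [e t = 1 / (2 l sin (t/2))] and [l = N + 1/2], the function
   [cos (l t) e t - sawtooth_tail N t] vanishes at [PI] and its derivative is [cos (l t) e' t],
   so it is dominated by [e]. *)
Lemma sawtooth_tail_bound (N : nat) (x : R) : 0 < x <= PI ->
  Rabs (sawtooth_tail N x) <= / ((INR N + / 2) * sin (x / 2)).
Proof.
  intros Hx.
  set (l := INR N + / 2); assert (Hl : 0 < l) by (unfold l; pose proof (pos_INR N); lra).
  pose (e := fun t => / (2 * l * sin (t / 2))).
  pose (e' := fun t => - cos (t / 2) / (4 * l * (sin (t / 2) * sin (t / 2)))).
  pose (W := fun t => cos (l * t) * e t - sawtooth_tail N t).
  assert (De : forall t, 0 < t <= PI -> is_derive e t (e' t)).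
  { intros t Ht; pose proof (sin_half_pos t Ht); unfold e, e'; auto_derive.
    - apply Rgt_not_eq; repeat apply Rmult_lt_0_compat; lra.
    - unfold Rdiv; field; lra. }
  assert (DW : forall t, 0 < t <= PI -> is_derive W t (cos (l * t) * e' t)).
  { intros t Ht; pose proof (sin_half_pos t Ht) as Hs; unfold W.
    replace (cos (l * t) * e' t) with (minus (plus (mult (- (l * sin (l * t))) (e t))
       (mult (cos (l * t)) (e' t))) (- (/ 2 + sum_n_m (fun n => cos (INR n * t)) 1 N))).
    - apply (is_derive_minus (V := R_NormedModule) (fun t => cos (l * t) * e t)).
      + apply (is_derive_mult (fun t => cos (l * t)) e).
        * auto_derive; auto; ring.
        * now apply De.
        * intros; unfold mult; simpl; ring.
      + apply is_derive_sawtooth_tail.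
    - unfold minus, plus, opp, mult; simpl; unfold e.
      assert (D : / 2 + sum_n_m (fun n => cos (INR n * t)) 1 N
                  = sin (l * t) / (2 * sin (t / 2))).
      { unfold l; rewrite <- dirichlet_kernel; field; lra. }
      rewrite D; field; lra. }
  assert (WP : W PI = 0).
  { unfold W, sawtooth_tail; replace (l * PI) with (INR N * PI + PI / 2)
      by (unfold l; field).
    rewrite cos_plus, cos_PI2, sin_INR_PI.
    rewrite (sum_n_m_ext _ (fun _ => 0)).
    - rewrite sum_n_m_const; field.
    - intros n; rewrite sin_INR_PI; apply Rmult_0_l. }
  assert (ep : forall t, 0 < t <= PI -> 0 < e t).
  { intros t Ht; pose proof (sin_half_pos t Ht); apply Rinv_0_lt_compat.
    repeat apply Rmult_lt_0_compat; lra. }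
  assert (e'n : forall t, 0 < t <= PI -> e' t <= 0).
  { intros t Ht; pose proof (sin_half_pos t Ht); unfold e'.
    assert (0 <= cos (t / 2)) by (apply cos_ge_0; lra).
    unfold Rdiv; rewrite <- Ropp_mult_distr_l; apply Ropp_le_cancel.
    rewrite Ropp_involutive, Ropp_0; apply Rmult_le_pos; [auto|].
    left; apply Rinv_0_lt_compat; repeat apply Rmult_lt_0_compat; lra. }
  (* [e - s * W] has derivative [e' * (1 - s * cos)], which is nonpositive, so on (0, PI] it is at
     least its value [e PI > 0] at PI. The two signs together bound the absolute value of [W] by
     [e]. *)
  assert (K : forall s, s = 1 \/ s = -1 -> s * W x <= e x).
  { intros s Hs.
    destruct (Req_dec x PI) as [->|Hne].
    { rewrite WP, Rmult_0_r; left; apply ep; lra. }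
    destruct (MVT_gen (fun t => e t - s * W t) x PI (fun t => e' t - s * (cos (l * t) * e' t)))
      as [c [Hc E]].
    - rewrite Rmin_left, Rmax_right by lra; intros t Ht.
      apply (is_derive_minus (V := R_NormedModule)); [apply De; lra|].
      apply (is_derive_scal W); apply DW; lra.
    - rewrite Rmin_left, Rmax_right by lra; intros t Ht.
      apply continuity_pt_filterlim.
      apply (continuous_minus (V := R_NormedModule) e (fun t => s * W t)).
      + eapply is_derive_continuous; apply De; lra.
      + apply (continuous_scal_r (V := R_NormedModule)).
        eapply is_derive_continuous; apply DW; lra.
    - rewrite Rmin_left, Rmax_right in Hc by lra; rewrite WP in E.
      pose proof (e'n c ltac:(lra)); pose proof (COS_bound (l * c)).
      pose proof (ep PI ltac:(lra)).
      assert ((e' c - s * (cos (l * c) * e' c)) * (PI - x) <= 0); [|lra].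
      apply Rmult_le_0_r; [|lra].
      destruct Hs as [-> | ->]; nra. }
  (* [sawtooth_tail] is [cos * e - W], and each of the two terms is at most [e] in absolute value:
     hence the bound [2 * e x]. *)
  pose proof (K 1 ltac:(auto)); pose proof (K (-1) ltac:(auto)).
  pose proof (COS_bound (l * x)); pose proof (ep x Hx).
  replace (/ (l * sin (x / 2))) with (2 * e x).
  2:{ unfold e; pose proof (sin_half_pos x Hx); field; lra. }
  unfold W in *; apply Rabs_le; split; nra.
Qed.

(** With y = x/2 the Taylor bound sin y >= y - y^3/6 is at least y/3 as soon as y <= 2, which the
    crude estimate PI <= 4 ensures. *)
Lemma sin_half_ge (x : R) : 0 <= x <= PI -> x / 6 <= sin (x / 2).
Proof.
  intros Hx; pose proof PI_4.
  destruct (pre_sin_bound (x / 2) 0) as [H1 _]; [lra|lra|].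
  unfold sin_approx, sin_term in H1; simpl in H1.
  refine (Rle_trans _ _ _ _ H1).
  assert (0 <= (x / 2) * (4 - (x / 2) * (x / 2))) by (apply Rmult_le_pos; nra).
  lra.
Qed.

(* Pointwise convergence at [0] of the cosine series of [f]; the vanishing of [f'] at [0] is
   what makes [f' * sawtooth_tail N] tend to [0] uniformly. *)
Lemma cosine_series_at_0 (f f' : R -> R) (M : R) (A : nat -> R) :
  (forall x, is_derive f x (f' x)) -> (forall x, continuous f' x) ->
  (forall x, 0 <= x <= PI -> Rabs (f' x) <= M * x) ->
  (forall n, is_RInt (fun x => f x * cos (INR n * x)) 0 PI (A n)) ->
  is_lim_seq (fun N => A 0%nat / 2 + sum_n_m A 1 N) (PI / 2 * f 0).
Proof.
  intros Df Cf Mf HA; pose proof PI_RGT_0 as HPI.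
  assert (HM : 0 <= M).
  { pose proof (Mf PI ltac:(lra)); pose proof (Rabs_pos (f' PI)); nra. }
  pose (D := fun N x => / 2 + sum_n_m (fun n => cos (INR n * x)) 1 N).
  assert (HS : forall N, is_RInt (fun x => f x * D N x) 0 PI (A 0%nat / 2 + sum_n_m A 1 N)).
  { intros N; unfold D; induction N as [|N IH].
    - rewrite sum_n_m_1_0, Rplus_0_r.
      apply (is_RInt_ext (V := R_NormedModule) (fun x => scal (/ 2) (f x * cos (INR 0 * x)))).
      + intros x _; rewrite sum_n_m_1_0; simpl INR; rewrite Rmult_0_l, cos_0.
        unfold scal; simpl; unfold mult; simpl; rring.
      + replace (A 0%nat / 2) with (scal (/ 2) (A 0%nat))
          by (unfold scal; simpl; unfold mult; simpl; field).
        apply (is_RInt_scal (V := R_NormedModule)), HA.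
    - rewrite sum_n_m_1_S, <- Rplus_assoc.
      apply (is_RInt_ext (V := R_NormedModule) (fun x => plus (f x *
         (/ 2 + sum_n_m (fun n => cos (INR n * x)) 1 N)) (f x * cos (INR (S N) * x)))).
      + intros x _; rewrite sum_n_m_1_S; unfold plus; simpl; rring.
      + apply (is_RInt_plus (V := R_NormedModule)); [exact IH|apply HA]. }
  assert (CV : forall N x, continuous (sawtooth_tail N) x).
  { intros N x; eapply is_derive_continuous; apply is_derive_sawtooth_tail. }
  assert (CD : forall N x, continuous (D N) x).
  { intros N x; unfold D; induction N as [|N IH].
    - apply (continuous_ext (fun _ => / 2)); [|apply continuous_const].
      intros t; rewrite sum_n_m_1_0; rring.
    - apply (continuous_ext (fun x => plus (/ 2 + sum_n_m (fun n => cos (INR n * x)) 1 N)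
         (cos (INR (S N) * x)))).
      + intros t; rewrite sum_n_m_1_S; unfold plus; simpl; rring.
      + apply (continuous_plus (V := R_NormedModule)); [exact IH|].
        apply (ex_derive_continuous (V := R_NormedModule)); auto_derive; auto. }
  (* Integration by parts: the boundary term at PI vanishes and the one at 0 is the claimed limit,
     so the error of the partial sum is exactly this integral. *)
  assert (HI : forall N, is_RInt (fun x => f' x * sawtooth_tail N x) 0 PI
    ((A 0%nat / 2 + sum_n_m A 1 N) - PI / 2 * f 0)).
  { intros N.
    assert (E0 : sawtooth_tail N 0 = PI / 2).
    { unfold sawtooth_tail; rewrite (sum_n_m_ext _ (fun _ => 0)).
      - rewrite sum_n_m_const; field.
      - intros n; rewrite Rmult_0_r, sin_0; apply Rmult_0_l. }
    assert (E1 : sawtooth_tail N PI = 0).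
    { unfold sawtooth_tail; rewrite (sum_n_m_ext _ (fun _ => 0)).
      - rewrite sum_n_m_const; field.
      - intros n; rewrite sin_INR_PI; apply Rmult_0_l. }
    assert (P : is_RInt (fun x => f' x * sawtooth_tail N x - f x * D N x) 0 PI
                 (f PI * sawtooth_tail N PI - f 0 * sawtooth_tail N 0)).
    { apply (is_RInt_primitive _ (fun x => f x * sawtooth_tail N x)).
      - intros x; replace (f' x * sawtooth_tail N x - f x * D N x) with
          (plus (mult (f' x) (sawtooth_tail N x)) (mult (f x) (- D N x)))
          by (unfold plus, mult; simpl; ring).
        apply (is_derive_mult f (sawtooth_tail N)); [apply Df| |].
        + apply is_derive_sawtooth_tail.
        + intros; unfold mult; simpl; ring.
      - intros x; apply (continuous_minus (V := R_NormedModule));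
          apply (continuous_mult (K := R_AbsRing)); auto.
        + eapply is_derive_continuous; apply Df. }
    rewrite E0, E1 in P.
    replace (A 0%nat / 2 + sum_n_m A 1 N - PI / 2 * f 0) with
      (plus (f PI * 0 - f 0 * (PI / 2)) (A 0%nat / 2 + sum_n_m A 1 N))
      by (unfold plus; simpl; field).
    apply (is_RInt_ext (V := R_NormedModule) (fun x => plus
      (f' x * sawtooth_tail N x - f x * D N x) (f x * D N x))).
    - intros x _; unfold plus; simpl; rring.
    - now apply (is_RInt_plus (V := R_NormedModule)). }
  assert (Bd : forall N, Rabs ((A 0%nat / 2 + sum_n_m A 1 N) - PI / 2 * f 0)
                         <= 6 * M * PI * / (INR N + / 2)).
  { intros N; pose proof (pos_INR N).
    replace (6 * M * PI * / (INR N + / 2)) with ((PI - 0) * (6 * M * / (INR N + / 2))) by ring.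
    apply (norm_RInt_le_const (V := R_NormedModule) _ 0 PI _ _) with (3 := HI N); [lra|].
    intros x Hx; unfold norm; simpl; unfold abs; simpl; rewrite Rabs_mult.
    destruct (Req_dec x 0) as [->|Hx0].
    { pose proof (Mf 0 ltac:(lra)) as Z; rewrite Rmult_0_r in Z.
      pose proof (Rabs_pos (f' 0)); replace (Rabs (f' 0)) with 0 by lra.
      rewrite Rmult_0_l; apply Rmult_le_pos; [lra|].
      left; apply Rinv_0_lt_compat; lra. }
    pose proof (sawtooth_tail_bound N x ltac:(lra)) as BV.
    pose proof (sin_half_ge x Hx) as Bs.
    apply Rle_trans with ((M * x) * / ((INR N + / 2) * (x / 6))).
    - apply Rmult_le_compat; auto using Rabs_pos.
      apply Rle_trans with (1 := BV); apply Rinv_le_contravar.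
      + apply Rmult_lt_0_compat; lra.
      + apply Rmult_le_compat_l; lra.
    - right; field; lra. }
  apply is_lim_seq_ext with (fun N => ((A 0%nat / 2 + sum_n_m A 1 N) - PI / 2 * f 0)
                                      + PI / 2 * f 0).
  { intros N; ring. }
  replace (Finite (PI / 2 * f 0)) with (Rbar_plus 0 (PI / 2 * f 0)) by (simpl; f_equal; ring).
  apply is_lim_seq_plus'; [|apply is_lim_seq_const].
  apply is_lim_seq_abs_0.
  apply is_lim_seq_le_le with (fun _ => 0) (fun N => 6 * M * PI * / (INR N + / 2)).
  - intros N; split; [apply Rabs_pos|apply Bd].
  - apply is_lim_seq_const.
  - replace (Finite 0) with (Rbar_mult (6 * M * PI) 0) by (simpl; f_equal; ring).
    apply is_lim_seq_scal_l.
    replace (Finite 0) with (Rbar_inv p_infty) by reflexivity.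
    apply is_lim_seq_inv; [|discriminate].
    apply is_lim_seq_plus with p_infty (/ 2); [apply is_lim_seq_INR|apply is_lim_seq_const|].
    reflexivity.
Qed.

(** * Partial fractions of the cosecant and alternating zeta values *)

(** The derivative of cos (a x) is bounded by a^2 x on [0, PI], as the convergence criterion at 0
    requires. Dividing the cosine series by sin (a PI) / 2 leaves the partial fractions. *)
Lemma cosecant_partial_fractions (a : R) : 0 < a < 1 ->
  is_lim_seq (fun N => / a + sum_n_m (fun n => (-1) ^ n * (/ (a + INR n) + / (a - INR n))) 1 N)
    (PI / sin (a * PI)).
Proof.
  intros Ha; pose proof PI_RGT_0 as HPI.
  assert (Hs : 0 < sin (a * PI)) by (apply sin_gt_0; nra).
  assert (Hn : forall n, a - INR n <> 0).
  { intros [|n]; [simpl; lra|rewrite S_INR; pose proof (pos_INR n); lra]. }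
  (* The integral of cos (a x) cos (n x) over [0, PI], by the product formula and sin ((a + n) PI) =
     sin ((a - n) PI) = (-1)^n sin (a PI). *)
  pose (A := fun n => sin (a * PI) / 2 * ((-1) ^ n * (/ (a + INR n) + / (a - INR n)))).
  assert (L : is_lim_seq (fun N => A 0%nat / 2 + sum_n_m A 1 N) (PI / 2 * cos (a * 0))).
  { apply (cosine_series_at_0 (fun x => cos (a * x)) (fun x => - (a * sin (a * x))) (a * a)).
    - intros x; auto_derive; auto; ring.
    - intros x; apply (ex_derive_continuous (V := R_NormedModule)); auto_derive; auto.
    - intros x Hx; rewrite Rabs_Ropp, Rabs_mult, (Rabs_pos_eq a), Rmult_assoc by lra.
      apply Rmult_le_compat_l; [lra|].
      destruct (Req_dec x 0) as [->|Hx0].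
      + rewrite Rmult_0_r, sin_0, Rabs_R0; lra.
      + assert (0 < a * x) by (apply Rmult_lt_0_compat; lra).
        rewrite Rabs_pos_eq; [left; now apply sin_lt_x|].
        apply sin_ge_0; nra.
    - intros n; pose proof (pos_INR n); specialize (Hn n).
      assert (E : sin ((a + INR n) * PI) = (-1) ^ n * sin (a * PI)).
      { rewrite Rmult_plus_distr_r, sin_plus, cos_INR_PI, sin_INR_PI; ring. }
      assert (E' : sin ((a - INR n) * PI) = (-1) ^ n * sin (a * PI)).
      { rewrite Rmult_minus_distr_r, sin_minus, cos_INR_PI, sin_INR_PI; ring. }
      pose (F := fun x => sin ((a + INR n) * x) / (2 * (a + INR n))
                          + sin ((a - INR n) * x) / (2 * (a - INR n))).
      replace (A n) with (F PI - F 0).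
      2:{ unfold A, F; rewrite E, E', !Rmult_0_r, sin_0; field; split; lra. }
      apply is_RInt_primitive.
      + intros x; unfold F; auto_derive; auto.
        replace ((a + INR n) * x) with (a * x + INR n * x) by ring.
        replace ((a - INR n) * x) with (a * x - INR n * x) by ring.
        rewrite cos_plus, cos_minus; field; split; lra.
      + intros x; apply (ex_derive_continuous (V := R_NormedModule)); auto_derive; auto. }
  rewrite Rmult_0_r, cos_0, Rmult_1_r in L.
  apply (is_lim_seq_scal_l _ (2 / sin (a * PI))) in L.
  replace (Finite (PI / sin (a * PI))) with (Rbar_mult (2 / sin (a * PI)) (PI / 2)).
  2:{ simpl; f_equal; field; lra. }
  refine (is_lim_seq_ext _ _ _ _ L); intros N; unfold A.
  rewrite sum_n_m_Rmult_l; simpl INR; rewrite Rplus_0_r, Rminus_0_r; simpl pow; field; lra.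
Qed.

(** A primitive performing two integrations by parts at once: the terms in u' sin cancel, leaving u
    cos + u'' cos / c^2. *)
Lemma is_derive_cosine_parts (u u' : R -> R) (c x l : R) : c <> 0 ->
  is_derive u x (u' x) -> is_derive u' x l ->
  is_derive (fun x => u x * (sin (c * x) / c) + u' x * (cos (c * x) / c ^ 2)) x
    (u x * cos (c * x) + l * (cos (c * x) / c ^ 2)).
Proof.
  intros Hc Du Du'; auto_derive.
  - repeat split; eexists; eassumption.
  - replace (Derive (fun x => u x) x) with (u' x) by (symmetry; now apply is_derive_unique).
    replace (Derive (fun x => u' x) x) with l by (symmetry; now apply is_derive_unique).
    field; auto.
Qed.

(** The map x -> x / (2 PI) + 1/2 sends [0, PI] onto [1/2, 1], so the first derivative at 0 is a
    multiple of B_(2k+1) (1/2) = 0 and the series may be evaluated there. The index [S k] keeps the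
    exponent at least 2. *)
Lemma alternating_zeta_even (B : nat -> R -> R) (k : nat) : is_bernoulli_polynomials B ->
  is_lim_seq (fun N => sum_n_m (fun n => (-1) ^ n / INR n ^ (2 * S k)) 1 N)
    ((-1) ^ S k * (2 ^ (2 * S k) - 2) * B (2 * S k)%nat 0 * PI ^ (2 * S k)
       / (2 * INR (fact (2 * S k)))).
Proof.
  intros HB; pose proof PI_RGT_0 as HPI.
  pose (c := / (2 * PI)).
  assert (c0 : 0 < c) by (apply Rinv_0_lt_compat; lra).
  pose (f := fun j x => B j (c * x + / 2)).
  assert (f0 : forall j, f j 0 = B j (/ 2)).
  { intros j; unfold f; f_equal; ring. }
  assert (f1 : forall j, f j PI = B j 1).
  { intros j; unfold f, c; f_equal; field; lra. }
  assert (Df : forall j x, is_derive (f (S j)) x (c * (INR (S j) * f j x))).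
  { intros j x; apply (is_derive_comp_affine (B (S j)) c (/ 2) x (INR (S j) * B j (c * x + / 2))).
    now apply bernoulli_derive. }
  assert (Cf : forall j x, continuous (f j) x).
  { intros j x; apply (continuous_comp (fun x => c * x + / 2) (B j)).
    - apply (ex_derive_continuous (V := R_NormedModule)); auto_derive; auto.
    - now apply bernoulli_continuous. }
  (* The first derivative vanishes at 0, so the mean value theorem and a bound [m] on [f (2 * k)],
     to which the second derivative is proportional, give the linear bound. *)
  assert (Mf : exists M, forall x, 0 <= x <= PI ->
      Rabs (c * (INR (2 * S k) * f (2 * k + 1)%nat x)) <= M * x).
  { destruct (continuity_ab_maj (fun x => Rabs (f (2 * k)%nat x)) 0 PI) as [y [Hy _]]; [lra| |].
    { intros x _; apply continuity_pt_filterlim.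
      apply (continuous_comp (f (2 * k)%nat) Rabs); [apply Cf|apply continuous_Rabs]. }
    set (m := Rabs (f (2 * k)%nat y)) in Hy.
    exists (c * (INR (2 * S k) * (c * (INR (2 * k + 1) * m)))).
    intros x Hx; pose proof (pos_INR (2 * S k)); pose proof (pos_INR (2 * k + 1)).
    rewrite !Rabs_mult, (Rabs_pos_eq c), (Rabs_pos_eq (INR (2 * S k))), !Rmult_assoc by lra.
    apply Rmult_le_compat_l; [lra|]; apply Rmult_le_compat_l; [lra|].
    destruct (Req_dec x 0) as [->|Hx0].
    { rewrite f0, bernoulli_odd_half, Rabs_R0, !Rmult_0_r by auto; lra. }
    destruct (MVT_open (f (2 * k + 1)%nat) (fun x => c * (INR (2 * k + 1) * f (2 * k)%nat x))
      0 x) as [z [Hz E]]; [lra| |].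
    { intros t; rewrite Nat.add_1_r; apply Df. }
    rewrite f0, bernoulli_odd_half in E by auto.
    rewrite Rminus_0_r, Rminus_0_r in E; rewrite E.
    rewrite !Rabs_mult, (Rabs_pos_eq c), (Rabs_pos_eq (INR (2 * k + 1))),
      (Rabs_pos_eq x), !Rmult_assoc by lra.
    apply Rmult_le_compat_l; [lra|]; apply Rmult_le_compat_l; [lra|].
    apply Rmult_le_compat_r; [lra|]; apply Hy; lra. }
  destruct Mf as [M Mf].
  (* Two integrations by parts pass from [B (2 j + 2)] to [B (2 j)]. *)
  assert (Hcos : forall n j, (1 <= n)%nat ->
    is_RInt (fun x => f (2 * S j)%nat x * cos (INR n * x)) 0 PI
      ((-1) ^ j * (-1) ^ n * (INR (fact (2 * S j)) * c ^ (2 * j + 1)) / (2 * INR n ^ (2 * S j)))).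
  { intros n j Hn.
    assert (Hn0 : INR n <> 0) by (apply not_0_INR; lia).
    pose (d := fun j => c * INR (2 * S j) * (c * INR (2 * j + 1))).
    (* The sine boundary terms vanish at both ends and the cosine term vanishes at 0, so only
       B_(2j+1) 1 at PI remains. It is 1/2 for j = 0 and 0 afterwards: a single boundary term
       generates all the coefficients. *)
    assert (Parts : forall j v,
      is_RInt (fun x => f (2 * j)%nat x * cos (INR n * x)) 0 PI v ->
      is_RInt (fun x => f (2 * S j)%nat x * cos (INR n * x)) 0 PI
        (c * INR (2 * S j) * B (2 * j + 1)%nat 1 * (-1) ^ n / INR n ^ 2
          - d j / INR n ^ 2 * v)).
    { clear j; intros j v Hv.
      pose (F := fun x => f (2 * S j)%nat x * (sin (INR n * x) / INR n)
          + c * (INR (2 * S j) * f (2 * j + 1)%nat x) * (cos (INR n * x) / INR n ^ 2)).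
      assert (P : is_RInt (fun x => f (2 * S j)%nat x * cos (INR n * x)
         + d j / INR n ^ 2 * (f (2 * j)%nat x * cos (INR n * x))) 0 PI (F PI - F 0)).
      { apply is_RInt_primitive.
        - intros x.
          assert (D1 := Df (2 * j + 1)%nat x); assert (D2 := Df (2 * j)%nat x).
          replace (S (2 * j + 1)) with (2 * S j)%nat in D1 by lia.
          replace (S (2 * j)) with (2 * j + 1)%nat in D2 by lia.
          apply (is_derive_scal _ _ (c * INR (2 * S j))) in D2.
          apply (is_derive_ext _ (fun x => c * (INR (2 * S j) * f (2 * j + 1)%nat x))) in D2;
            [|intros t; rring].
          pose proof (is_derive_cosine_parts _ _ (INR n) x _ Hn0 D1 D2) as D.
          replace (d j / INR n ^ 2 * (f (2 * j)%nat x * cos (INR n * x))) with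
            (c * INR (2 * S j) * (c * (INR (2 * j + 1) * f (2 * j)%nat x))
              * (cos (INR n * x) / INR n ^ 2)) by (unfold d; field; auto).
          exact D.
        - intros x; apply (continuous_plus (V := R_NormedModule)
            (fun x => f (2 * S j)%nat x * cos (INR n * x))).
          + apply (continuous_mult (K := R_AbsRing)); [apply Cf|].
            apply (ex_derive_continuous (V := R_NormedModule)); auto_derive; auto.
          + apply (continuous_mult (K := R_AbsRing)); [apply continuous_const|].
            apply (continuous_mult (K := R_AbsRing)); [apply Cf|].
            apply (ex_derive_continuous (V := R_NormedModule)); auto_derive; auto. }
      replace (c * INR (2 * S j) * B (2 * j + 1)%nat 1 * (-1) ^ n / INR n ^ 2
          - d j / INR n ^ 2 * v) with (minus (F PI - F 0) (scal (d j / INR n ^ 2) v)).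
      2:{ unfold F; rewrite !f1, !f0, (bernoulli_odd_half B HB j), Rmult_0_r, sin_0,
            sin_INR_PI, cos_INR_PI.
          unfold minus, plus, opp, scal; simpl; unfold mult; simpl; field; auto. }
      apply (is_RInt_ext (V := R_NormedModule) (fun x => minus
        (f (2 * S j)%nat x * cos (INR n * x)
         + d j / INR n ^ 2 * (f (2 * j)%nat x * cos (INR n * x)))
        (scal (d j / INR n ^ 2) (f (2 * j)%nat x * cos (INR n * x))))).
      - intros x _; unfold minus, plus, opp, scal; simpl; unfold mult; simpl; rring.
      - apply (is_RInt_minus (V := R_NormedModule)); [exact P|].
        now apply (is_RInt_scal (V := R_NormedModule)). }
    induction j as [|j IH].
    - assert (Z : is_RInt (fun x => f (2 * 0)%nat x * cos (INR n * x)) 0 PI 0).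
      { apply (is_RInt_ext (V := R_NormedModule) (fun x => cos (INR n * x))).
        - intros x _; unfold f; simpl; rewrite bernoulli_0 by auto; rring.
        - replace 0 with (sin (INR n * PI) / INR n - sin (INR n * 0) / INR n) at 2
            by (rewrite sin_INR_PI, Rmult_0_r, sin_0; field; auto).
          apply (is_RInt_primitive _ (fun x => sin (INR n * x) / INR n)).
          + intros x; auto_derive; auto; field; auto.
          + intros x; apply (ex_derive_continuous (V := R_NormedModule)); auto_derive; auto. }
      apply Parts in Z.
      replace (B (2 * 0 + 1)%nat 1) with (/ 2) in Z by (symmetry; now apply bernoulli_1).
      match goal with |- is_RInt _ _ _ ?v => match type of Z with is_RInt _ _ _ ?w =>
        replace v with w; [exact Z|] end end.
      simpl; field; auto.
    - apply Parts in IH.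
      replace (B (2 * S j + 1)%nat 1) with 0 in IH.
      2:{ replace (2 * S j + 1)%nat with (S (S (2 * j + 1))) by lia.
          rewrite bernoulli_0_1 by auto.
          replace (S (S (2 * j + 1))) with (2 * j + 3)%nat by lia.
          symmetry; now apply bernoulli_odd_0. }
      match goal with |- is_RInt _ _ _ ?v => match type of IH with is_RInt _ _ _ ?w =>
        replace v with w; [exact IH|] end end.
      unfold d.
      replace (2 * S (S j))%nat with (S (S (2 * S j))) by lia.
      replace (2 * S j + 1)%nat with (S (2 * S j)) by lia.
      replace (2 * j + 1)%nat with (S (2 * j)) by lia.
      rewrite !fact_simpl, !mult_INR.
      replace (2 * S j)%nat with (S (S (2 * j))) by lia.
      rewrite <- !tech_pow_Rmult.
      assert (INR n ^ (2 * j) <> 0) by now apply pow_nonzero.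
      field; auto. }
  (* The constant coefficient is set apart, since the general formula would divide by a power of 0.
     Its value is 0 because B_(2k+3) vanishes at 1/2 and at 1. *)
  pose (A := fun n => match n with O => 0 | S _ =>
    (-1) ^ k * (-1) ^ n * (INR (fact (2 * S k)) * c ^ (2 * k + 1)) / (2 * INR n ^ (2 * S k)) end).
  assert (L : is_lim_seq (fun N => A 0%nat / 2 + sum_n_m A 1 N) (PI / 2 * f (2 * S k)%nat 0)).
  { apply (cosine_series_at_0 _ (fun x => c * (INR (2 * S k) * f (2 * k + 1)%nat x)) M).
    - intros x; replace (2 * S k)%nat with (S (2 * k + 1)) by lia; apply Df.
    - intros x; apply (continuous_mult (K := R_AbsRing)); [apply continuous_const|].
      apply (continuous_mult (K := R_AbsRing)); [apply continuous_const|apply Cf].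
    - exact Mf.
    - intros [|n]; [|now apply Hcos; lia].
      pose (F := fun x => f (2 * S k + 1)%nat x / (c * INR (2 * S k + 1))).
      assert (Hm : INR (2 * S k + 1) <> 0) by (apply not_0_INR; lia).
      replace (A 0%nat) with (F PI - F 0).
      2:{ unfold F, A; rewrite f1, f0, (bernoulli_odd_half B HB (S k)).
          replace (2 * S k + 1)%nat with (S (S (2 * k + 1))) by lia.
          rewrite bernoulli_0_1 by auto.
          replace (S (S (2 * k + 1))) with (2 * k + 3)%nat by lia.
          rewrite bernoulli_odd_0 by auto; unfold Rdiv; ring. }
      apply (is_RInt_ext (V := R_NormedModule) (f (2 * S k)%nat)).
      { intros x _; simpl INR; rewrite Rmult_0_l, cos_0; rring. }
      apply is_RInt_primitive; [|apply Cf].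
      intros x; pose proof (Df (2 * S k)%nat x) as D.
      replace (S (2 * S k)) with (2 * S k + 1)%nat in D by lia.
      apply (is_derive_scal _ _ (/ (c * INR (2 * S k + 1)))) in D.
      replace (f (2 * S k)%nat x) with
        (/ (c * INR (2 * S k + 1)) * (c * (INR (2 * S k + 1) * f (2 * S k)%nat x)))
        by (field; lra).
      apply (is_derive_ext _ _ _ _ (fun t => Rmult_comm _ _) D). }
  rewrite f0, bernoulli_half in L by auto.
  assert (Hf : INR (fact (2 * S k)) <> 0) by apply INR_fact_neq_0.
  assert (Hc : c ^ (2 * k + 1) <> 0) by (apply pow_nonzero; lra).
  assert (Hk : (-1) ^ k * (-1) ^ k = 1).
  { rewrite <- Rpow_mult_distr; replace (-1 * -1) with 1 by ring; apply pow1. }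
  apply (is_lim_seq_scal_l _ ((-1) ^ k * 2 / (INR (fact (2 * S k)) * c ^ (2 * k + 1)))) in L.
  match goal with |- is_lim_seq _ (Finite ?v) =>
    match type of L with is_lim_seq _ (Rbar_mult (Finite ?a) (Finite ?b)) =>
    replace v with (a * b) end end.
  - refine (is_lim_seq_ext _ _ _ _ L); intros N.
    assert (A0 : A 0%nat / 2 = 0) by (change (A 0%nat) with 0; field).
    rewrite A0, Rplus_0_l.
    rewrite <- sum_n_m_Rmult_l.
    apply sum_n_m_ext_loc; intros [|n] Hn; [lia|].
    assert (INR (S n) <> 0) by (apply not_0_INR; lia).
    assert (INR (S n) ^ (2 * S k) <> 0) by now apply pow_nonzero.
    unfold A.
    transitivity (((-1) ^ k * (-1) ^ k) * ((-1) ^ S n / INR (S n) ^ (2 * S k)));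
      [change_eq_R; field; auto|rewrite Hk; apply Rmult_1_l].
  - unfold c; rewrite pow_inv, Rpow_mult_distr.
    assert (P : forall r, r ^ (2 * S k) = r * r ^ (2 * k + 1)).
    { intros r; now replace (2 * S k)%nat with (S (2 * k + 1)) by lia. }
    rewrite !P, <- (tech_pow_Rmult (-1)).
    assert (2 ^ (2 * k + 1) <> 0) by (apply pow_nonzero; lra).
    assert (PI ^ (2 * k + 1) <> 0) by (apply pow_nonzero; lra).
    field; auto.
Qed.

(** * Euler-Maclaurin expansion of the harmonic numbers *)

Lemma sum_n_m_Rplus (a b : nat -> R) (n m : nat) :
  sum_n_m (fun k => a k + b k) n m = sum_n_m a n m + sum_n_m b n m.
Proof. exact (sum_n_m_plus (G := R_AbelianMonoid) a b n m). Qed.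

Lemma is_lim_seq_inv_INR : is_lim_seq (fun n => / INR n) 0.
Proof.
  replace (Finite 0) with (Rbar_inv p_infty) by reflexivity.
  apply is_lim_seq_inv; [apply is_lim_seq_INR|discriminate].
Qed.

Definition harmonic (n : nat) : R := sum_n_m (fun k => / INR k) 1 n.

Lemma harmonic_S (n : nat) : harmonic (S n) = harmonic n + / INR (S n).
Proof. apply sum_n_m_1_S. Qed.

(** Both sides are ln y <= y - 1, at y = n / (n+1) and at y = (n+1) / n. *)
Lemma ln_S_bound (n : nat) : (1 <= n)%nat -> / INR (S n) <= ln (INR (S n)) - ln (INR n) <= / INR n.
Proof.
  intros Hn; assert (0 < INR n) by (apply lt_0_INR; lia).
  assert (0 < INR (S n)) by (apply lt_0_INR; lia).
  assert (L : forall y, 0 < y -> ln y <= y - 1).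
  { intros y Hy; pose proof (exp_ineq1_le (ln y)); rewrite exp_ln in *; lra. }
  rewrite <- ln_div by auto; split.
  - apply Ropp_le_cancel; rewrite <- ln_Rinv by (apply Rdiv_lt_0_compat; auto).
    rewrite Rinv_div; refine (Rle_trans _ _ _ (L _ _) _).
    + apply Rdiv_lt_0_compat; auto.
    + right; rewrite S_INR in *; field; lra.
  - refine (Rle_trans _ _ _ (L _ _) _).
    + apply Rdiv_lt_0_compat; auto.
    + right; rewrite S_INR; field; lra.
Qed.

Lemma continuous_div_shift_pow (f : R -> R) (c x : R) (n : nat) :
  continuous f x -> c + x <> 0 -> continuous (fun t => f t / (c + t) ^ n) x.
Proof.
  intros Hf Hx; apply (continuous_mult (K := R_AbsRing)); [exact Hf|].
  apply (ex_derive_continuous (V := R_NormedModule)); auto_derive.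
  now apply pow_nonzero.
Qed.

Section EulerMaclaurin.

Variable B : nat -> R -> R.
Hypothesis HB : is_bernoulli_polynomials B.

Definition harmonic_remainder (m j : nat) : R :=
  harmonic j - ln (INR j) - euler_gamma - / (2 * INR j)
  + sum_n_m (fun k => B (2 * k)%nat 0 / (2 * INR k * INR j ^ (2 * k))) 1 m.

(** The primitive - B_(n+1) t / ((n+1) (j+t)^(n+1)) has derivative B_(n+1) t / (j+t)^(n+2) - B_n t /
    (j+t)^(n+1): the exponent is matched to the index so that both factors n+1 cancel. *)
Lemma is_RInt_bernoulli_parts (j n : nat) (v : R) : (1 <= j)%nat ->
  is_RInt (fun t => B n t / (INR j + t) ^ (n + 1)) 0 1 v ->
  is_RInt (fun t => B (n + 1)%nat t / (INR j + t) ^ (n + 2)) 0 1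
    (v - (B (n + 1)%nat 1 / INR (S j) ^ (n + 1) - B (n + 1)%nat 0 / INR j ^ (n + 1))
          / INR (n + 1)).
Proof.
  intros Hj Hv.
  assert (Hj0 : 0 < INR j) by (apply lt_0_INR; lia).
  assert (Hn : 0 < INR (n + 1)) by (apply lt_0_INR; lia).
  pose (F := fun t => - (B (n + 1)%nat t / (INR (n + 1) * (INR j + t) ^ (n + 1)))).
  assert (P : is_RInt (fun t => B (n + 1)%nat t / (INR j + t) ^ (n + 2)
      - B n t / (INR j + t) ^ (n + 1)) 0 1 (F 1 - F 0)).
  { apply (is_RInt_derive (V := R_CompleteNormedModule) F).
    - intros x; rewrite Rmin_left, Rmax_right by lra; intros Hx.
      assert (Hp : forall k, (INR j + x) ^ k <> 0) by (intros k; apply pow_nonzero; lra).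
      pose proof (bernoulli_derive B HB n x) as D; rewrite <- Nat.add_1_r in D.
      unfold F; revert D; generalize (B (n + 1)%nat) (B n x); intros b u D.
      apply (is_derive_ext (fun t => b t * (- / INR (n + 1) * / (INR j + t) ^ (n + 1)))).
      { intros t; unfold Rdiv; rewrite Rinv_mult; rring. }
      auto_derive.
      + split; [eexists; eassumption|split; [apply Hp|auto]].
      + replace (Derive (fun t => b t) x) with (INR (n + 1) * u)
          by (symmetry; now apply is_derive_unique).
        replace (pred (n + 1)) with n by lia; pose proof (Hp n).
        rewrite !pow_add; simpl; field; lra.
    - intros x; rewrite Rmin_left, Rmax_right by lra; intros Hx.
      apply (continuous_minus (V := R_NormedModule)
        (fun t => B (n + 1)%nat t / (INR j + t) ^ (n + 2))
        (fun t => B n t / (INR j + t) ^ (n + 1))); apply continuous_div_shift_pow;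
        solve [now apply bernoulli_continuous|lra]. }
  assert (E : F 1 - F 0 = - ((B (n + 1)%nat 1 / INR (S j) ^ (n + 1)
                - B (n + 1)%nat 0 / INR j ^ (n + 1)) / INR (n + 1))).
  { unfold F; rewrite Rplus_0_r, S_INR; field.
    repeat split; try apply pow_nonzero; lra. }
  rewrite E in P.
  match goal with |- is_RInt _ _ _ (?a - ?b) => replace (a - b) with (plus (- b) a) end.
  2:{ unfold plus; simpl; ring. }
  apply (is_RInt_ext (V := R_NormedModule) (fun t => plus (B (n + 1)%nat t / (INR j + t) ^ (n + 2)
      - B n t / (INR j + t) ^ (n + 1)) (B n t / (INR j + t) ^ (n + 1)))).
  - intros x _; unfold plus; simpl; rring.
  - now apply (is_RInt_plus (V := R_NormedModule)).
Qed.

(** Start from ln (j+1) - ln j as the integral of 1 / (j+t) and raise the index by parts. One step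
    produces the terms 1 / (2j) and 1 / (2 (j+1)); from then on each pair of steps adds one
    Bernoulli term, because the odd Bernoulli numbers from the third on vanish. *)
Lemma harmonic_remainder_step (m j : nat) : (1 <= j)%nat ->
  is_RInt (fun t => (B (2 * m + 2)%nat t - B (2 * m + 2)%nat 0) / (INR j + t) ^ (2 * m + 3)) 0 1
    (harmonic_remainder m j - harmonic_remainder m (S j)).
Proof.
  intros Hj; assert (Hj0 : 0 < INR j) by (apply lt_0_INR; lia).
  assert (HSj : INR (S j) = INR j + 1) by apply S_INR.
  pose (e := fun m => harmonic_remainder m j - harmonic_remainder m (S j)).
  assert (eS : forall m, e (S m) = e m - B (2 * m + 2)%nat 0 *
     (/ INR (S j) ^ (2 * m + 2) - / INR j ^ (2 * m + 2)) / INR (2 * m + 2)).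
  { clear m; intros m; unfold e, harmonic_remainder; rewrite !sum_n_m_1_S.
    replace (2 * S m)%nat with (2 * m + 2)%nat by lia.
    replace (2 * INR (S m)) with (INR (2 * m + 2))
      by (replace (2 * m + 2)%nat with (2 * S m)%nat by lia; now rewrite mult_INR).
    assert (INR (2 * m + 2) <> 0) by (apply not_0_INR; lia).
    assert (INR j ^ (2 * m + 2) <> 0) by (apply pow_nonzero; lra).
    assert (INR (S j) ^ (2 * m + 2) <> 0) by (apply pow_nonzero; lra).
    set (s1 := sum_n_m _ 1 m); set (s2 := sum_n_m _ 1 m); clearbody s1 s2.
    field; repeat split; auto; lra. }
  assert (I0 : is_RInt (fun t => B 1%nat t / (INR j + t) ^ 2) 0 1 (e 0%nat)).
  { assert (L : is_RInt (fun t => B 0%nat t / (INR j + t) ^ (0 + 1)) 0 1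
                 (ln (INR j + 1) - ln (INR j + 0))).
    { apply (is_RInt_derive (V := R_CompleteNormedModule) (fun t => ln (INR j + t)));
        intros x; rewrite Rmin_left, Rmax_right by lra; intros Hx.
      - rewrite bernoulli_0 by auto; auto_derive; [lra|rewrite Nat.add_0_l, pow_1; field; lra].
      - apply continuous_div_shift_pow;
        solve [now apply bernoulli_continuous|lra]. }
    apply is_RInt_bernoulli_parts in L; [|auto].
    destruct (bernoulli_1 B HB) as [E0 E1].
    simpl (0 + 1)%nat in L; simpl (0 + 2)%nat in L; rewrite E0, E1 in L.
    replace (e 0%nat) with (ln (INR j + 1) - ln (INR j + 0) -
      (/ 2 / INR (S j) ^ 1 - - / 2 / INR j ^ 1) / INR 1); [exact L|].
    unfold e, harmonic_remainder; rewrite !sum_n_m_1_0, harmonic_S, Rplus_0_r, HSj.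
    simpl; field; lra. }
  assert (I : forall m, is_RInt (fun t => B (2 * m + 2)%nat t / (INR j + t) ^ (2 * m + 3)) 0 1
    (e (S m))).
  { clear m; induction m as [|m IH].
    - apply is_RInt_bernoulli_parts in I0; [|auto].
      simpl (1 + 1)%nat in I0; rewrite bernoulli_0_1 in I0 by auto.
      rewrite eS; simpl (2 * 0 + 2)%nat.
      match goal with |- is_RInt _ _ _ ?v => match type of I0 with is_RInt _ _ _ ?w =>
        replace v with w; [exact I0|] end end.
      unfold Rdiv; ring.
    - replace (2 * m + 3)%nat with (2 * m + 2 + 1)%nat in IH by lia.
      apply (is_RInt_bernoulli_parts j (2 * m + 2) _ Hj) in IH.
      replace (2 * m + 2 + 1)%nat with (2 * m + 3)%nat in IH by lia.
      replace (B (2 * m + 3)%nat 1) with 0 in IH.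
      2:{ replace (2 * m + 3)%nat with (S (S (2 * m + 1))) by lia.
          rewrite bernoulli_0_1 by auto.
          replace (S (S (2 * m + 1))) with (2 * m + 3)%nat by lia.
          symmetry; now apply bernoulli_odd_0. }
      rewrite bernoulli_odd_0 in IH by auto.
      replace (2 * m + 2 + 2)%nat with (2 * m + 3 + 1)%nat in IH by lia.
      apply (is_RInt_bernoulli_parts j (2 * m + 3) _ Hj) in IH.
      replace (2 * m + 3 + 1)%nat with (2 * S m + 2)%nat in IH by lia.
      replace (2 * m + 3 + 2)%nat with (2 * S m + 3)%nat in IH by lia.
      replace (B (2 * S m + 2)%nat 1) with (B (2 * S m + 2)%nat 0) in IH.
      2:{ replace (2 * S m + 2)%nat with (S (S (2 * S m))) by lia.
          symmetry; now apply bernoulli_0_1. }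
      rewrite (eS (S m)).
      match goal with |- is_RInt _ _ _ ?v => match type of IH with is_RInt _ _ _ ?w =>
        replace v with w; [exact IH|] end end.
      unfold Rdiv; ring. }
  (* The integral of [B (2 * m + 2)] alone is the increment of order [S m]. Subtracting the constant
     [b] from the polynomial removes exactly the last Bernoulli term, which brings back order m and
     makes the sign of the integrand constant. *)
  set (b := B (2 * m + 2)%nat 0).
  assert (P : is_RInt (fun t => b / (INR j + t) ^ (2 * m + 3)) 0 1
    (- (b / (INR (2 * m + 2) * (INR j + 1) ^ (2 * m + 2)))
     - - (b / (INR (2 * m + 2) * (INR j + 0) ^ (2 * m + 2))))).
  { apply (is_RInt_derive (V := R_CompleteNormedModule)
      (fun t => - (b / (INR (2 * m + 2) * (INR j + t) ^ (2 * m + 2)))));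
      intros x; rewrite Rmin_left, Rmax_right by lra; intros Hx.
    - assert (Hp : forall k, (INR j + x) ^ k <> 0) by (intros k; apply pow_nonzero; lra).
      assert (Hn : INR (2 * m + 2) <> 0) by (apply not_0_INR; lia).
      replace (2 * m + 3)%nat with (S (2 * m + 2)) by lia.
      revert Hn; generalize (2 * m + 2)%nat; intros [|n] Hn; [easy|].
      set (c := INR (S n)) in *; auto_derive.
      + apply Rmult_integral_contrapositive_currified; [exact Hn|apply (Hp (S n))].
      + fold c; change (match n with 0%nat => 1 | S _ => INR n + 1 end) with c.
        pose proof (Hp n); simpl; field; repeat split; auto; lra.
    - apply (continuous_div_shift_pow (fun _ => b)); [apply continuous_const|lra]. }
  fold (e m); replace (e m) with (minus (e (S m))
    (- (b / (INR (2 * m + 2) * (INR j + 1) ^ (2 * m + 2)))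
     - - (b / (INR (2 * m + 2) * (INR j + 0) ^ (2 * m + 2))))).
  2:{ rewrite eS, HSj, Rplus_0_r; fold b; unfold minus, plus, opp; simpl.
      change (@eq R (e m - b * (/ (INR j + 1) ^ (2 * m + 2) - / INR j ^ (2 * m + 2)) / INR (2 * m + 2)
        + - (- (b / (INR (2 * m + 2) * (INR j + 1) ^ (2 * m + 2)))
     - - (b / (INR (2 * m + 2) * (INR j) ^ (2 * m + 2))))) (e m)).
      unfold Rdiv; rewrite !Rinv_mult; ring. }
  apply (is_RInt_ext (V := R_NormedModule) (fun t => minus
    (B (2 * m + 2)%nat t / (INR j + t) ^ (2 * m + 3)) (b / (INR j + t) ^ (2 * m + 3)))).
  - intros x _; unfold minus, plus, opp, Rdiv; simpl; rring.
  - now apply (is_RInt_minus (V := R_NormedModule)).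
Qed.

Lemma harmonic_remainder_mono (m j : nat) : (1 <= j)%nat ->
  (-1) ^ (m + 1) * harmonic_remainder m (S j) < (-1) ^ (m + 1) * harmonic_remainder m j.
Proof.
  intros Hj; assert (Hj0 : 0 < INR j) by (apply lt_0_INR; lia).
  pose proof (harmonic_remainder_step m j Hj) as I.
  apply (is_RInt_scal (V := R_NormedModule) _ _ _ ((-1) ^ (m + 1))) in I.
  apply (is_RInt_unique (V := R_CompleteNormedModule)) in I.
  match type of I with RInt ?g _ _ = _ => assert (P : 0 < RInt g 0 1) end.
  { apply RInt_gt_0; [lra| |].
    - intros x Hx; pose proof (bernoulli_even_sign B HB m x Hx) as Sg.
      unfold scal; simpl; unfold mult; simpl; unfold Rdiv; rewrite <- Rmult_assoc.
      apply Rmult_lt_0_compat; [exact Sg|apply Rinv_0_lt_compat, pow_lt; lra].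
    - intros x Hx; apply (continuous_scal_r (V := R_NormedModule) ((-1) ^ (m + 1))
        (fun t => (B (2 * m + 2)%nat t - B (2 * m + 2)%nat 0) / (INR j + t) ^ (2 * m + 3))).
      apply (continuous_div_shift_pow (fun t => B (2 * m + 2)%nat t - B (2 * m + 2)%nat 0));
        [|lra].
      apply (continuous_minus (V := R_NormedModule) (B (2 * m + 2)%nat) (fun _ => B (2 * m + 2)%nat 0));
        [now apply bernoulli_continuous|apply continuous_const]. }
  rewrite I in P; unfold scal in P; simpl in P; unfold mult in P; simpl in P; lra.
Qed.

Lemma harmonic_remainder_mono_lt (m i j : nat) : (1 <= i)%nat -> (i < j)%nat ->
  (-1) ^ (m + 1) * harmonic_remainder m j < (-1) ^ (m + 1) * harmonic_remainder m i.
Proof.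
  intros Hi Hij; induction Hij as [|j Hij IH]; [now apply harmonic_remainder_mono|].
  pose proof (harmonic_remainder_mono m j ltac:(lia)); lra.
Qed.

(** [euler_gamma] is only the value of [Lim_seq], so convergence has to be proved. Since gamma
    cancels in differences of [harmonic_remainder], the case m = 0 shows that H_n - ln n - 1/(2n)
    increases, and the bound H_n - ln n <= 1 makes it converge. *)
Lemma euler_gamma_lim : is_lim_seq (fun n => harmonic n - ln (INR n)) euler_gamma.
Proof.
  assert (U : forall n, harmonic (S n) - ln (INR (S n)) <= 1).
  { induction n as [|n IH].
    - rewrite harmonic_S; unfold harmonic; rewrite sum_n_m_1_0; simpl; rewrite ln_1; lra.
    - rewrite harmonic_S; pose proof (ln_S_bound (S n) ltac:(lia)); lra. }
  assert (X : ex_finite_lim_seq (fun n => harmonic (S n) - ln (INR (S n)) - / (2 * INR (S n)))).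
  { apply ex_finite_lim_seq_incr with 1.
    - intros n; pose proof (harmonic_remainder_mono 0 (S n) ltac:(lia)) as L.
      unfold harmonic_remainder in L; rewrite !sum_n_m_1_0 in L; simpl ((-1) ^ (0 + 1)) in L; lra.
    - intros n; specialize (U n).
      assert (0 < / (2 * INR (S n))); [|lra].
      apply Rinv_0_lt_compat; pose proof (lt_0_INR (S n) ltac:(lia)); lra. }
  destruct X as [l Hl].
  assert (L : is_lim_seq (fun n => harmonic n - ln (INR n)) l).
  { apply is_lim_seq_incr_1.
    apply is_lim_seq_ext with (fun n => (harmonic (S n) - ln (INR (S n)) - / (2 * INR (S n)))
       + / 2 * / INR (S n)).
    { intros n; rewrite Rinv_mult; ring. }
    replace (Finite l) with (Finite (l + / 2 * 0)) by (f_equal; ring).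
    apply is_lim_seq_plus'; [exact Hl|].
    apply (is_lim_seq_scal_l _ (/ 2) 0), (is_lim_seq_incr_1 (fun n => / INR n)), is_lim_seq_inv_INR. }
  change euler_gamma with (real (Lim_seq (fun n => harmonic n - ln (INR n)))).
  rewrite (is_lim_seq_unique _ _ L); exact L.
Qed.

End EulerMaclaurin.

(** * Wallis' product *)

Definition wallis (n : nat) : R := RInt (fun x => cos x ^ n) 0 (PI / 2).

Lemma continuous_cos_pow (n : nat) (x : R) : continuous (fun x => cos x ^ n) x.
Proof. apply (ex_derive_continuous (V := R_NormedModule)); auto_derive; auto. Qed.

Lemma is_RInt_wallis (n : nat) : is_RInt (fun x => cos x ^ n) 0 (PI / 2) (wallis n).
Proof.
  apply (RInt_correct (V := R_CompleteNormedModule)).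
  apply (ex_RInt_continuous (V := R_CompleteNormedModule)); intros; apply continuous_cos_pow.
Qed.

Lemma wallis_0 : wallis 0 = PI / 2.
Proof.
  apply (is_RInt_unique (V := R_CompleteNormedModule)).
  replace (PI / 2) with (PI / 2 - 0) at 2 by ring.
  apply (is_RInt_primitive _ (fun x => x)).
  - intros x; simpl; auto_derive; auto.
  - intros x; apply continuous_cos_pow.
Qed.

Lemma wallis_1 : wallis 1 = 1.
Proof.
  apply (is_RInt_unique (V := R_CompleteNormedModule)).
  replace 1 with (sin (PI / 2) - sin 0) by (rewrite sin_PI2, sin_0; ring).
  apply is_RInt_primitive.
  - intros x; auto_derive; auto; simpl; ring.
  - intros x; apply continuous_cos_pow.
Qed.

(** The derivative of cos^(n+1) sin is (n+2) cos^(n+2) - (n+1) cos^n, and this function vanishes at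
    0 and at PI / 2. *)
Lemma wallis_SS (n : nat) : INR (S (S n)) * wallis (S (S n)) = INR (S n) * wallis n.
Proof.
  assert (P : is_RInt (fun x => INR (S (S n)) * cos x ^ S (S n) - INR (S n) * cos x ^ n)
    0 (PI / 2) (INR (S (S n)) * wallis (S (S n)) - INR (S n) * wallis n)).
  { apply (is_RInt_minus (V := R_NormedModule));
      apply (is_RInt_scal (V := R_NormedModule)), is_RInt_wallis. }
  assert (P' : is_RInt (fun x => INR (S (S n)) * cos x ^ S (S n) - INR (S n) * cos x ^ n)
    0 (PI / 2) 0).
  { replace 0 with (cos (PI / 2) ^ S n * sin (PI / 2) - cos 0 ^ S n * sin 0) at 2
      by (rewrite cos_PI2, sin_0, pow_i by lia; ring).
    apply (is_RInt_primitive _ (fun x => cos x ^ S n * sin x)).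
    - intros x; rewrite (S_INR (S n)); auto_derive; auto.
      change (match n with 0%nat => 1 | S _ => INR n + 1 end) with (INR (S n)).
      pose proof (sin2_cos2 x) as E; unfold Rsqr in E; simpl pred.
      rewrite <- !tech_pow_Rmult.
      transitivity (- INR (S n) * cos x ^ n * (sin x * sin x) + cos x * cos x * cos x ^ n);
        [ring|replace (sin x * sin x) with (1 - cos x * cos x) by lra; ring].
    - intros x; apply (ex_derive_continuous (V := R_NormedModule)); auto_derive; auto. }
  apply (is_RInt_unique (V := R_CompleteNormedModule)) in P, P'; lra.
Qed.

Lemma wallis_pos (n : nat) : 0 < wallis n.
Proof.
  pose proof PI_RGT_0; apply RInt_gt_0; [lra| |intros; apply continuous_cos_pow].
  intros x Hx; apply pow_lt, cos_gt_0; lra.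
Qed.

Lemma wallis_decr (n : nat) : wallis (S n) <= wallis n.
Proof.
  pose proof PI_RGT_0; apply RInt_le; [lra|eexists; apply is_RInt_wallis|eexists; apply is_RInt_wallis|].
  intros x Hx; assert (0 <= cos x) by (apply cos_ge_0; lra).
  pose proof (COS_bound x); pose proof (pow_le (cos x) n ltac:(auto)); simpl; nra.
Qed.

(** Unrolled, the recursion gives the ratio of odd to even factors for even index and the ratio of
    even to odd factors for odd index; the logarithm of either ratio is the alternating sum up to
    its end terms. *)
Lemma ln_wallis (M : nat) :
  ln (wallis (2 * M)) = ln (PI / 2) - sum_n_m (fun n => (-1) ^ n * ln (INR n)) 1 (2 * M) /\
  ln (wallis (2 * M + 1)) = sum_n_m (fun n => (-1) ^ n * ln (INR n)) 1 (2 * M)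
                            - ln (INR (2 * M + 1)).
Proof.
  assert (R : forall n, ln (wallis (S (S n))) = ln (wallis n) + ln (INR (S n)) - ln (INR (S (S n)))).
  { intros n; pose proof (wallis_pos n); pose proof (wallis_pos (S (S n))).
    assert (0 < INR (S n)) by (apply lt_0_INR; lia).
    assert (0 < INR (S (S n))) by (apply lt_0_INR; lia).
    pose proof (f_equal ln (wallis_SS n)) as E; rewrite !ln_mult in E by auto; lra. }
  induction M as [|M [IH1 IH2]].
  - rewrite sum_n_m_1_0; simpl (2 * 0)%nat; simpl (0 + 1)%nat; rewrite wallis_0, wallis_1.
    simpl INR; rewrite ln_1; lra.
  - replace (2 * S M)%nat with (S (S (2 * M))) by lia.
    rewrite !sum_n_m_1_S, pow_1_odd.
    replace (S (S (2 * M))) with (2 * S M)%nat at 2 5 by lia; rewrite pow_1_even.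
    replace (S (S (2 * M)) + 1)%nat with (S (S (2 * M + 1))) by lia.
    rewrite !R, IH1, IH2.
    replace (2 * M + 1)%nat with (S (2 * M)) by lia.
    replace (2 * S M)%nat with (S (S (2 * M))) by lia; lra.
Qed.

(** The sequence equals -2 ln (PI/2) + 2 ln (W_(2M) / W_(2M+1)) - ln ((2M+1) / (2M)), where W is
    [wallis]. Monotonicity and the recursion put W_(2M) / W_(2M+1) between 1 and (2M+1) / (2M), so
    the error is at most 1 / (2M) in absolute value. *)
Lemma alternating_ln_lim : is_lim_seq (fun M =>
  - 4 * sum_n_m (fun n => (-1) ^ n * ln (INR n)) 1 (2 * M) + ln (INR (2 * M)) + ln (INR (2 * M + 1)))
  (- 2 * ln (PI / 2)).
Proof.
  (* The shift excludes M = 0, where neither W_(2M-1) nor the logarithm of 2M makes sense. *)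
  apply is_lim_seq_incr_1.
  apply is_lim_seq_le_le with (fun M => - 2 * ln (PI / 2) - / INR (S M))
    (fun M => - 2 * ln (PI / 2) + 2 * / INR (S M)).
  - intros M; destruct (ln_wallis (S M)) as [E1 E2].
    pose proof (wallis_decr (2 * S M)) as D1; pose proof (wallis_decr (2 * M + 1)) as D2.
    pose proof (wallis_SS (2 * M + 1)) as E3.
    replace (S (2 * M + 1)) with (2 * S M)%nat in * by lia.
    replace (S (2 * S M)) with (2 * S M + 1)%nat in * by lia.
    pose proof (wallis_pos (2 * S M)); pose proof (wallis_pos (2 * S M + 1)).
    pose proof (wallis_pos (2 * M + 1)).
    apply ln_le in D1; auto; apply ln_le in D2; auto.
    apply (f_equal ln) in E3; rewrite !ln_mult in E3 by (auto; apply lt_0_INR; lia).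
    pose proof (ln_S_bound (2 * S M) ltac:(lia)) as L.
    replace (S (2 * S M)) with (2 * S M + 1)%nat in L by lia.
    assert (/ INR (2 * S M) <= / INR (S M)).
    { apply Rinv_le_contravar; [apply lt_0_INR; lia|apply le_INR; lia]. }
    pose proof (Rinv_0_lt_compat (INR (2 * S M + 1)) ltac:(apply lt_0_INR; lia)).
    set (S4 := sum_n_m _ 1 (2 * S M)) in *; clearbody S4; split; lra.
  - replace (Finite (- 2 * ln (PI / 2))) with (Finite (- 2 * ln (PI / 2) - 0)) by (f_equal; ring).
    apply is_lim_seq_minus'; [apply is_lim_seq_const|].
    apply (is_lim_seq_incr_1 (fun n => / INR n)), is_lim_seq_inv_INR.
  - replace (Finite (- 2 * ln (PI / 2))) with (Finite (- 2 * ln (PI / 2) + 2 * 0))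
      by (f_equal; ring).
    apply is_lim_seq_plus'; [apply is_lim_seq_const|].
    apply (is_lim_seq_scal_l _ 2 0), (is_lim_seq_incr_1 (fun n => / INR n)), is_lim_seq_inv_INR.
Qed.

(** * The cosecant sum *)

Lemma sum_inv_add (a q : nat) :
  sum_n_m (fun k => / (INR k + INR a)) 1 q = harmonic (a + q) - harmonic a.
Proof.
  induction q as [|q IH]; [rewrite sum_n_m_1_0, Nat.add_0_r; rring|].
  rewrite sum_n_m_1_S, IH, Nat.add_succ_r, harmonic_S, <- plus_INR.
  replace (S q + a)%nat with (S (a + q)) by lia; rring.
Qed.

Lemma sum_inv_sub (a q : nat) : (q <= a)%nat ->
  sum_n_m (fun k => / (INR k - INR (S a))) 1 q = harmonic (a - q) - harmonic a.
Proof.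
  induction q as [|q IH]; intros Hq; [rewrite sum_n_m_1_0, Nat.sub_0_r; rring|].
  rewrite sum_n_m_1_S, IH by lia.
  replace (a - q)%nat with (S (a - S q)) by lia; rewrite harmonic_S.
  replace (INR (S q) - INR (S a)) with (- INR (S (a - S q))).
  - rewrite Rinv_opp; rring.
  - replace (S (a - S q)) with (S a - S q)%nat by lia; rewrite minus_INR by lia; rring.
Qed.

Definition cosecant_partial_sum (p N : nat) : R :=
  sum_n_m (fun k => / (INR k / INR p) + sum_n_m (fun n =>
    (-1) ^ n * (/ (INR k / INR p + INR n) + / (INR k / INR p - INR n))) 1 N) 1 (p - 1).

(** Summed over k, the terms of order n give p (-1)^n (H ((n+1) p - 1) - H (n p) + H ((n-1) p) - H
    (n p - 1)). Thus H (n p), up to a correction 1 / (n p), occurs twice in block n and once in each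
    neighbouring block, all with sign -(-1)^n: hence the factor -4. The last block lacks a
    successor, which leaves the boundary terms. *)
Lemma cosecant_partial_sum_harmonic (p N : nat) : (1 <= p)%nat ->
  cosecant_partial_sum p N = INR p *
    (- 4 * sum_n_m (fun n => (-1) ^ n * (harmonic (n * p) - / (2 * INR (n * p)))) 1 N
     + (-1) ^ N * (harmonic (N * p) + harmonic (S N * p) - / INR (S N * p))).
Proof.
  intros Hp; assert (Hp0 : 0 < INR p) by (apply lt_0_INR; lia).
  induction N as [|N IH]; unfold cosecant_partial_sum in *.
  - rewrite sum_n_m_1_0.
    rewrite (sum_n_m_ext_loc _ (fun k => INR p * / INR k)).
    2:{ intros k Hk; rewrite sum_n_m_1_0; assert (0 < INR k) by (apply lt_0_INR; lia).
        change_eq_R; field; lra. }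
    rewrite sum_n_m_Rmult_l; fold (harmonic (p - 1)).
    replace (1 * p)%nat with (S (p - 1)) by lia; rewrite harmonic_S.
    unfold harmonic at 2; rewrite sum_n_m_1_0; simpl pow; ring.
  - rewrite (sum_n_m_ext_loc _ (fun k => (/ (INR k / INR p) + sum_n_m (fun n =>
      (-1) ^ n * (/ (INR k / INR p + INR n) + / (INR k / INR p - INR n))) 1 N)
      + (-1) ^ S N * INR p *
        (/ (INR k + INR (S N * p)) + / (INR k - INR (S (S N * p - 1)))))).
    2:{ intros k Hk; rewrite sum_n_m_1_S, <- Rplus_assoc; f_equal; rewrite Rmult_assoc; f_equal.
        replace (S (S N * p - 1)) with (S N * p)%nat by lia.
        assert (0 < INR k) by (apply lt_0_INR; lia).
        assert (INR k < INR p) by (apply lt_INR; lia).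
        rewrite mult_INR; pose proof (pos_INR N); rewrite S_INR.
        assert (INR k - (INR N + 1) * INR p < 0) by nra.
        assert (0 <= (INR N + 1) * INR p) by nra.
        field; repeat split; nra. }
    rewrite sum_n_m_Rplus, IH, sum_n_m_Rmult_l, sum_n_m_Rplus, sum_inv_add, sum_inv_sub by lia.
    rewrite sum_n_m_1_S.
    replace (S N * p - 1 - (p - 1))%nat with (N * p)%nat by lia.
    replace (S (S N) * p)%nat with (S (S N * p + (p - 1))) by lia.
    rewrite (harmonic_S (S N * p + (p - 1))).
    assert (E : harmonic (S N * p) = harmonic (S N * p - 1) + / INR (S N * p)).
    { replace (S N * p)%nat with (S (S N * p - 1)) at 1 3 by lia; apply harmonic_S. }
    assert (INR (S N * p) <> 0) by (apply not_0_INR; lia).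
    rewrite <- (tech_pow_Rmult (-1)), Rinv_mult; rewrite E.
    change_eq_R; field; split; [apply not_0_INR; lia|auto].
Qed.

Lemma is_lim_seq_sum_n_m (u : nat -> nat -> R) (l : nat -> R) (m : nat) :
  (forall k, (1 <= k <= m)%nat -> is_lim_seq (u k) (l k)) ->
  is_lim_seq (fun N => sum_n_m (fun k => u k N) 1 m) (sum_n_m l 1 m).
Proof.
  intros H; induction m as [|m IH].
  - rewrite sum_n_m_1_0; apply is_lim_seq_ext with (fun _ => 0); [|apply is_lim_seq_const].
    intros N; now rewrite sum_n_m_1_0.
  - rewrite sum_n_m_1_S.
    apply is_lim_seq_ext with (fun N => sum_n_m (fun k => u k N) 1 m + u (S m) N).
    { intros N; now rewrite sum_n_m_1_S. }
    apply is_lim_seq_plus'; [apply IH; intros; apply H; lia|apply H; lia].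
Qed.

Lemma is_lim_seq_cosecant_partial_sum (p : nat) : (1 <= p)%nat ->
  is_lim_seq (cosecant_partial_sum p) (PI * cosecant_sum p).
Proof.
  intros Hp; unfold cosecant_sum; rewrite <- sum_n_m_Rmult_l.
  apply is_lim_seq_sum_n_m; intros k Hk.
  assert (0 < INR k) by (apply lt_0_INR; lia).
  assert (INR k < INR p) by (apply lt_INR; lia).
  replace (PI * (1 / sin (INR k * PI / INR p))) with (PI / sin (INR k / INR p * PI)).
  - apply cosecant_partial_fractions; split.
    + apply Rdiv_lt_0_compat; lra.
    + apply (Rmult_lt_reg_r (INR p)); [lra|]; unfold Rdiv.
      rewrite Rmult_assoc, Rinv_l by lra; lra.
  - replace (INR k / INR p * PI) with (INR k * PI / INR p) by (field; lra).
    unfold Rdiv; ring.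
Qed.

(** Consecutive terms pair into positive differences. Keeping the first pair, rather than the bound
    0, provides a positive constant that persists in the limit M -> infinity. *)
Lemma alternating_sum_lower (u : nat -> R) (M : nat) : (1 <= M)%nat ->
  (forall n, (1 <= n)%nat -> u (S n) < u n) ->
  u 1%nat - u 2%nat <= - sum_n_m (fun n => (-1) ^ n * u n) 1 (2 * M).
Proof.
  intros HM Hu; induction HM as [|M HM IH].
  - simpl (2 * 1)%nat; rewrite !sum_n_m_1_S, sum_n_m_1_0; simpl; lra.
  - replace (2 * S M)%nat with (S (S (2 * M))) by lia.
    rewrite !sum_n_m_1_S, pow_1_odd.
    replace (S (S (2 * M))) with (2 * S M)%nat at 1 by lia; rewrite pow_1_even.
    pose proof (Hu (S (2 * M)) ltac:(lia)); lra.
Qed.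

Lemma alternating_ones (M : nat) : sum_n_m (fun n => (-1) ^ n) 1 (2 * M) = 0.
Proof.
  induction M as [|M IH]; [apply sum_n_m_1_0|].
  replace (2 * S M)%nat with (S (S (2 * M))) by lia.
  rewrite !sum_n_m_1_S, IH, pow_1_odd.
  replace (S (S (2 * M))) with (2 * S M)%nat by lia; rewrite pow_1_even; rring.
Qed.

(** * Expansion of the cosecant sum and sign of its error *)

Section Expansion.

Variable B : nat -> R -> R.
Hypothesis HB : is_bernoulli_polynomials B.
Variable p : nat.
Hypothesis Hp : (1 <= p)%nat.

(** The definition of [harmonic_remainder] at j = n p is solved for the harmonic number, ln (n p) is
    split, and the finite sums over n and k are exchanged. *)
Lemma alternating_harmonic_expansion (m N : nat) :
  sum_n_m (fun n => (-1) ^ n * (harmonic (n * p) - / (2 * INR (n * p)))) 1 N =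
  sum_n_m (fun n => (-1) ^ n * ln (INR n)) 1 N
  + sum_n_m (fun n => (-1) ^ n) 1 N * (ln (INR p) + euler_gamma)
  + sum_n_m (fun n => (-1) ^ n * harmonic_remainder B m (n * p)) 1 N
  - sum_n_m (fun k => B (2 * k)%nat 0 / (2 * INR k * INR p ^ (2 * k)) *
      sum_n_m (fun n => (-1) ^ n / INR n ^ (2 * k)) 1 N) 1 m.
Proof.
  assert (Hp0 : 0 < INR p) by (apply lt_0_INR; lia).
  induction N as [|N IH].
  - rewrite !sum_n_m_1_0.
    rewrite (sum_n_m_ext _ (fun _ => 0)).
    + rewrite sum_n_m_const; rring.
    + intros k; rewrite sum_n_m_1_0; apply Rmult_0_r.
  - rewrite !sum_n_m_1_S, IH.
    rewrite (sum_n_m_ext_loc (fun k => B (2 * k)%nat 0 / (2 * INR k * INR p ^ (2 * k)) *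
        sum_n_m (fun n => (-1) ^ n / INR n ^ (2 * k)) 1 (S N))
      (fun k => B (2 * k)%nat 0 / (2 * INR k * INR p ^ (2 * k)) *
        sum_n_m (fun n => (-1) ^ n / INR n ^ (2 * k)) 1 N
        + (-1) ^ S N * (B (2 * k)%nat 0 / (2 * INR k * INR (S N * p) ^ (2 * k))))).
    2:{ intros k Hk; rewrite sum_n_m_1_S, Rmult_plus_distr_l; f_equal.
        rewrite mult_INR, Rpow_mult_distr; unfold Rdiv; rewrite !Rinv_mult; change_eq_R; ring. }
    rewrite sum_n_m_Rplus, sum_n_m_Rmult_l; unfold harmonic_remainder.
    assert (E : ln (INR (S N * p)) = ln (INR (S N)) + ln (INR p)).
    { rewrite mult_INR; apply ln_mult; apply lt_0_INR; lia. }
    rewrite E; rring.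
Qed.

(** In the exact identity for [cosecant_partial_sum], everything except the alternating sum of
    remainders has a known limit along even N, so that sum converges too, and its limit is the error
    of the expansion of order m times PI / p. *)
Lemma alternating_remainder_lim (m : nat) :
  is_lim_seq (fun M => - 4 * sum_n_m (fun n => (-1) ^ n * harmonic_remainder B m (n * p)) 1 (2 * M))
    (PI * cosecant_sum p / INR p - 2 * (ln (INR p) + euler_gamma - ln (PI / 2))
     - sum_n_m (fun k => (-1) ^ k * ((2 ^ (2 * k) - 2) * B (2 * k)%nat 0 ^ 2 /
             (INR k * INR (fact (2 * k)))) * (PI / INR p) ^ (2 * k)) 1 m).
Proof.
  assert (Hp0 : 0 < INR p) by (apply lt_0_INR; lia).
  assert (Even : forall (u : nat -> R) l, is_lim_seq u l -> is_lim_seq (fun M => u (2 * M)%nat) l).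
  { intros u l; apply (is_lim_seq_subseq u l (fun M => (2 * M)%nat)), eventually_subseq.
    intros n; lia. }
  assert (Hh : forall phi : nat -> nat, (forall n, (phi n < phi (S n))%nat) ->
    is_lim_seq (fun M => harmonic (phi M * p) - ln (INR (phi M * p))) euler_gamma).
  { intros phi H; apply (is_lim_seq_subseq (fun n => harmonic n - ln (INR n)) euler_gamma
      (fun M => (phi M * p)%nat)); [apply eventually_subseq; intros n|now apply (euler_gamma_lim B HB)].
    apply Nat.mul_lt_mono_pos_r; [lia|apply H]. }
  assert (L1 := is_lim_seq_cosecant_partial_sum p Hp).
  apply Even, (is_lim_seq_scal_r _ (/ INR p)) in L1.
  assert (L2 := alternating_ln_lim).
  assert (L3 := Hh (fun M => 2 * M)%nat ltac:(intros; cbv beta; lia)).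
  assert (L4 := Hh (fun M => S (2 * M)) ltac:(intros; cbv beta; lia)).
  assert (L5 : is_lim_seq (fun M => / INR (S (2 * M) * p)) 0).
  { apply (is_lim_seq_subseq (fun n => / INR n) 0 (fun M => (S (2 * M) * p)%nat));
      [apply eventually_subseq; intros n|apply is_lim_seq_inv_INR].
    apply Nat.mul_lt_mono_pos_r; lia. }
  assert (L6 : is_lim_seq (fun M => sum_n_m (fun k => B (2 * k)%nat 0 / (2 * INR k * INR p ^ (2 * k)) *
      sum_n_m (fun n => (-1) ^ n / INR n ^ (2 * k)) 1 (2 * M)) 1 m)
    (sum_n_m (fun k => B (2 * k)%nat 0 / (2 * INR k * INR p ^ (2 * k)) *
      ((-1) ^ k * (2 ^ (2 * k) - 2) * B (2 * k)%nat 0 * PI ^ (2 * k)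
       / (2 * INR (fact (2 * k))))) 1 m)).
  { apply is_lim_seq_sum_n_m; intros [|k] Hk; [lia|].
    apply (is_lim_seq_scal_l _ _ (Finite _)).
    apply (Even (fun N => sum_n_m (fun n => (-1) ^ n / INR n ^ (2 * S k)) 1 N)).
    now apply alternating_zeta_even. }
  pose proof (is_lim_seq_minus' _ _ _ _ L1 (is_lim_seq_plus' _ _ _ _ L2
    (is_lim_seq_plus' _ _ _ _ L3 L4))) as L.
  apply (fun H => is_lim_seq_plus' _ _ _ _ H L5) in L.
  apply (is_lim_seq_scal_l _ 4 (Finite _)) in L6.
  apply (fun H => is_lim_seq_minus' _ _ _ _ H L6) in L.
  (* The boundary harmonic numbers carry ln (2 M p) and ln ((2 M + 1) p), whereas the Wallis limit
     contains these logarithms without p: the difference is 2 ln p. *)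
  apply (fun H => is_lim_seq_minus' _ _ _ _ H (is_lim_seq_const (2 * ln (INR p)))) in L.
  match goal with |- is_lim_seq _ (Finite ?v) => match type of L with is_lim_seq _ (Finite ?w) =>
    replace v with w end end.
  (* The shift makes 2 M positive, so that the logarithm of 2 M p splits. *)
  - apply is_lim_seq_incr_1; apply is_lim_seq_incr_1 in L.
    refine (is_lim_seq_ext _ _ _ _ L); intros M.
    rewrite cosecant_partial_sum_harmonic by auto.
    rewrite Rinv_r_simpl_m by lra.
    rewrite pow_1_even, (alternating_harmonic_expansion m), alternating_ones.
    assert (E : forall n, ln (INR (S n * p)) = ln (INR (S n)) + ln (INR p)).
    { intros n; rewrite mult_INR; apply ln_mult; [apply lt_0_INR; lia|auto]. }
    replace (2 * S M + 1)%nat with (S (2 * S M)) by lia.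
    replace (2 * S M)%nat with (S (2 * M + 1)) by lia.
    rewrite !E; rring.
  - rewrite <- sum_n_m_Rmult_l.
    rewrite (sum_n_m_ext_loc _ (fun k => (-1) ^ k * ((2 ^ (2 * k) - 2) * B (2 * k)%nat 0 ^ 2 /
             (INR k * INR (fact (2 * k)))) * (PI / INR p) ^ (2 * k))).
    + unfold Rdiv; rring.
    + intros k Hk; assert (INR k <> 0) by (apply not_0_INR; lia).
      pose proof (INR_fact_neq_0 (2 * k)).
      replace ((PI / INR p) ^ (2 * k)) with (PI ^ (2 * k) / INR p ^ (2 * k))
        by (unfold Rdiv; now rewrite Rpow_mult_distr, pow_inv).
      assert (INR p ^ (2 * k) <> 0) by (apply pow_nonzero; lra).
      change_eq_R; field; auto.
Qed.

(** Multiplied by (-1)^(m+1), the remainders at the multiples of p decrease strictly, so four times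
    their first difference is a positive lower bound for the limit, which is PI / p times the
    quantity claimed positive. *)
Lemma cosecant_sum_enveloped (m : nat) :
  0 < (-1) ^ (m + 1) * (cosecant_sum p -
    (2 * INR p / PI * (ln (INR p) + euler_gamma - ln (PI / 2)) +
      sum_n_m (fun k => (-1) ^ k *
          ((2 ^ (2 * k) - 2) * B (2 * k)%nat 0 ^ 2 /
             (INR k * INR (fact (2 * k)))) *
          (PI / INR p) ^ (2 * k - 1)) 1 m)).
Proof.
  assert (Hp0 : 0 < INR p) by (apply lt_0_INR; lia); pose proof PI_RGT_0 as HPI.
  pose (u := fun n => (-1) ^ (m + 1) * harmonic_remainder B m (n * p)).
  assert (Hu : forall n, (1 <= n)%nat -> u (S n) < u n).
  { intros n Hn; apply (harmonic_remainder_mono_lt B HB); nia. }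
  assert (L := alternating_remainder_lim m).
  apply (is_lim_seq_scal_l _ ((-1) ^ (m + 1)) (Finite _)), is_lim_seq_incr_1 in L.
  match type of L with is_lim_seq _ (Rbar_mult (Finite ?a) (Finite ?b)) =>
    assert (Hv : 4 * (u 1%nat - u 2%nat) <= a * b) end.
  { refine (is_lim_seq_le (fun _ => 4 * (u 1%nat - u 2%nat)) _ (Finite _) (Finite _) _
      (is_lim_seq_const _) L).
    intros M; pose proof (alternating_sum_lower u (S M) ltac:(lia) Hu) as A.
    rewrite (sum_n_m_ext _ (fun n => (-1) ^ (m + 1) * ((-1) ^ n * harmonic_remainder B m (n * p))))
      in A by (intros k; unfold u; rring).
    rewrite sum_n_m_Rmult_l in A; lra. }
  pose proof (Hu 1%nat ltac:(lia)) as U.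
  apply (Rmult_lt_reg_l (PI / INR p)); [now apply Rdiv_lt_0_compat|].
  rewrite Rmult_0_r; apply Rlt_le_trans with (4 * (u 1%nat - u 2%nat)); [lra|].
  refine (Rle_trans _ _ _ Hv (Req_le _ _ _)).
  rewrite (sum_n_m_ext_loc _ (fun k => PI / INR p * ((-1) ^ k *
      ((2 ^ (2 * k) - 2) * B (2 * k)%nat 0 ^ 2 / (INR k * INR (fact (2 * k)))) *
      (PI / INR p) ^ (2 * k - 1)))).
  - rewrite sum_n_m_Rmult_l; change_eq_R; field; lra.
  - intros k Hk; replace (2 * k)%nat with (S (2 * k - 1)) at 4 by lia.
    rewrite <- (tech_pow_Rmult (PI / INR p)); rring.
Qed.

End Expansion.

Theorem corollary11p4 :
  forall B : nat -> R -> R, is_bernoulli_polynomials B ->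
  forall p n : nat, (1 <= p)%nat ->
    cosecant_sum p <
      2 * INR p / PI * (ln (INR p) + euler_gamma - ln (PI / 2)) +
      sum_n_m (fun k => (-1) ^ k *
          ((2 ^ (2 * k) - 2) * B (2 * k)%nat 0 ^ 2 /
             (INR k * INR (fact (2 * k)))) *
          (PI / INR p) ^ (2 * k - 1)) 1 (2 * n)
    /\
    cosecant_sum p >
      2 * INR p / PI * (ln (INR p) + euler_gamma - ln (PI / 2)) +
      sum_n_m (fun k => (-1) ^ k *
          ((2 ^ (2 * k) - 2) * B (2 * k)%nat 0 ^ 2 /
             (INR k * INR (fact (2 * k)))) *
          (PI / INR p) ^ (2 * k - 1)) 1 (2 * n + 1).
Proof.
  intros B HB p n Hp.
  pose proof (cosecant_sum_enveloped B HB p Hp (2 * n)) as H1.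
  pose proof (cosecant_sum_enveloped B HB p Hp (2 * n + 1)) as H2.
  rewrite pow_m1_odd in H1.
  replace (2 * n + 1 + 1)%nat with (2 * (n + 1))%nat in H2 by lia; rewrite pow_1_even in H2.
  split; lra.
Qed.
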